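(* Let $L_+$ be an even Lie color algebra over a field $K$ with a proper grading by the abelian group $G$ and with bicharacter $\varepsilon:G\times G\to K^*$, let $U(L_+)$ be its enveloping algebra, and let $Q(U(L_+))$ be its symmetric Martindale quotient ring. Then: (1) The group of $X$-inner automorphisms of $U(L_+)$ is abelian. (2) The nonzero elements of $Q(U(L_+))$ which induce $X$-inner automorphisms of $U(L_+)$ are precisely the nonzero homogeneous semi-invariants under the adjoint action of $L_+$. (3) The group of nonzero homogeneous semi-invariants in $Q(U(L_+))$ (under multiplication) is nilpotent of class at most $2$.
   Context: Let $K$ be a field and $G$ an abelian group (written multiplicatively, identity $1$). An alternating bicharacter is a map $\varepsilon:G\times G\to K^*$ with $\varepsilon(g,hk)=\varepsilon(g,h)\varepsilon(g,k)$ and $\varepsilon(g,h)=\varepsilon(h,g)^{-1}$ for all $g,h,k\in G$. A Lie color algebra over $K$ is a $G$-graded $K$-vector space $L=\bigoplus_{g\in G}L_g$ with a $K$-bilinear bracket satisfying $[L_g,L_h]\subseteq L_{gh}$, $[x,y]=-\varepsilon(g,h)[y,x]$ and $[[x,y],z]=[x,[y,z]]-\varepsilon(g,h)[y,[x,z]]$ for all $x\in L_g$, $y\in L_h$, $z\in L$. It is even (written $L_+$) if $L_g=0$ whenever $\varepsilon(g,g)\ne 1$; in characteristic $2$ one additionally requires $[x,x]=0$ for homogeneous $x$. The elements of $\bigcup_g L_g$ are called homogeneous. The enveloping algebra $U(L_+)$ is the associative unital $K$-algebra generated by $L_+$ subject to the relations $xy-\varepsilon(g,h)yx=[x,y]$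 for all $x\in L_g$, $y\in L_h$. By the Poincaré–Birkhoff–Witt theorem, ordered monomials in a totally ordered homogeneous basis of $L_+$ form a $K$-basis of $U(L_+)$; $U(L_+)$ is a domain and is $G$-graded. The grading of $L_+$ by $G$ is proper if $\{g\in G\mid \varepsilon(g,k)=1\text{ for all }k\in G\}=\{1\}$ and $G$ is generated by the support $\{g\in G\mid L_g\neq0\}$ of $L_+$. For a prime ring $R$, $Q(R)$ denotes its symmetric Martindale quotient ring (the set of elements $q$ of the left Martindale quotient ring of $R$ for which there is a nonzero two-sided ideal $J$ of $R$ with $Jq\subseteq R$ and $qJ\subseteq R$), and $N(R)$ is the set of those $w\in Q(R)$ with $wR=Rw$. A nonzero $w\in N(R)$ induces the automorphism $\sigma$ of $R$ given by $r^\sigma w=wr$ for all $r\in R$; automorphisms arising in this way are called $X$-inner. Write $U=U(L_+)$, $Q=Q(U)$. The grading of $U$ corresponds to an action of $G$ on $U$ by automorphisms: $k\in G$ acts by $\varphi_k(r)=\varepsilon(k,g)r$ for $r\in U_g$. Each $\varphi_k$ extends uniquely to an automorphism of $Q$, and the grading is extended to $Q$ in this way: $q\in Q$ is homogeneous of degree $g$ (written $q\in Q_g$) if $\varphi_k(q)=\varepsilon(k,g)q$ for all $k\in G$. Each $x\in L_h$ acts on $U$ by the skew derivation $\delta_x(r)=xr-\varphi_h(r)x$, which extends uniquely to $Q$ by the same formula; thus $\delta_x(q)=xq-\varepsilon(h,g)qx$ for $q\in Q_g$. A homogeneous semi-invariant (under the adjoint action of $L_+$) is a homogeneous $q\in Q$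 such that for every homogeneous $x\in L_+$ there is $\alpha_x\in K$ with $\delta_x(q)=\alpha_x q$. *)

(* Defs.v *)
From HB Require Import structures.
From mathcomp Require Import all_boot all_algebra.

Set Implicit Arguments.
Unset Strict Implicit.
Unset Printing Implicit Defensive.

Import GRing.Theory.
Local Open Scope ring_scope.

(* Grading groups and groups of automorphisms or units may be infinite, so
   groups are boot's groupType, not the finite groups of fingroup. *)

Inductive generated (H : groupType) (A : H -> Prop) : H -> Prop :=
| generated_gen x : A x -> generated A x
| generated_one : generated A 1%g
| generated_mul x y : generated A x -> generated A y -> generated A (x * y)%g
| generated_inv x : generated A x -> generated A (x^-1)%g.

(* Shifted indexing: lower_central H c is the (c+1)-st term of the lower
   central series. *)
Fixpoint lower_central (H : groupType) (c : nat) : H -> Prop :=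
  if c is c'.+1 then
    generated (fun z => exists x y, lower_central c' x /\ z = commg x y)
  else fun _ => True.

Definition nilpotent_class_le (H : groupType) (c : nat) : Prop :=
  forall x : H, lower_central c x -> x = 1%g.

Definition abelian_group (H : groupType) : Prop :=
  forall x y : H, (x * y = y * x)%g.

(* The elements of T satisfying S form, under op and with identity e, a group
   that has the group-theoretic property P. *)
Definition forms_group (T : Type) (op : T -> T -> T) (e : T) (S : T -> Prop)
    (P : groupType -> Prop) : Prop :=
  exists (H : groupType) (f : H -> T),
    [/\ injective f, f 1%g = e,
        forall x y, f (x * y)%g = op (f x) (f y),
        forall t, S t <-> exists x, f x = t
      & P H].

Record alternating_bicharacter (K : fieldType) (G : groupType)
    (eps : G -> G -> K) : Prop := {
  bichar_neq0 : forall g h, eps g h != 0;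
  bicharM : forall g h k, eps g (h * k)%g = eps g h * eps g k;
  bicharV : forall g h, eps g h = (eps h g)^-1
}.

Record is_grading (K : fieldType) (G : groupType) (V : lmodType K)
    (V_ : G -> V -> Prop) : Prop := {
  grading0 : forall g, V_ g 0;
  gradingP : forall g (a : K) x y, V_ g x -> V_ g y -> V_ g (a *: x + y);
  grading_span : forall x, exists (s : seq G) (c : G -> V),
    (forall g, V_ g (c g)) /\ x = \sum_(g <- s) c g;
  grading_indep : forall (s : seq G) (c : G -> V), uniq s ->
    (forall g, V_ g (c g)) -> \sum_(g <- s) c g = 0 ->
    forall g, g \in s -> c g = 0
}.

Record lie_color_algebra (K : fieldType) (G : groupType) (eps : G -> G -> K)
    (L : lmodType K) (L_ : G -> L -> Prop) (br : L -> L -> L) : Prop := {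
  color_grading : is_grading L_;
  color_linearl : forall y (a : K) x x',
    br (a *: x + x') y = a *: br x y + br x' y;
  color_linearr : forall x (a : K) y y',
    br x (a *: y + y') = a *: br x y + br x y';
  color_degree : forall g h x y,
    L_ g x -> L_ h y -> L_ (g * h)%g (br x y);
  color_anti : forall g h x y,
    L_ g x -> L_ h y -> br x y = - (eps g h *: br y x);
  color_jacobi : forall g h x y z, L_ g x -> L_ h y ->
    br (br x y) z = br x (br y z) - eps g h *: br y (br x z)
}.

Record even_color (K : fieldType) (G : groupType) (eps : G -> G -> K)
    (L : lmodType K) (L_ : G -> L -> Prop) (br : L -> L -> L) : Prop := {
  even_odd_part : forall g, eps g g != 1 -> forall x, L_ g x -> x = 0;
  even_char2 : 2%N \in [pchar K] -> forall g x, L_ g x -> br x x = 0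
}.

Record proper_grading (K : fieldType) (G : groupType) (eps : G -> G -> K)
    (L : lmodType K) (L_ : G -> L -> Prop) : Prop := {
  proper_radical : forall g, (forall k, eps g k = 1) <-> g = 1%g;
  proper_generated : forall g,
    generated (fun h => exists2 x, L_ h x & x != 0) g
}.

Definition color_relations (K : fieldType) (G : groupType) (eps : G -> G -> K)
    (L : lmodType K) (L_ : G -> L -> Prop) (br : L -> L -> L)
    (A : algType K) (f : L -> A) : Prop :=
  forall g h x y, L_ g x -> L_ h y ->
    f x * f y - eps g h *: (f y * f x) = f (br x y).

(* iota : L -> U presents U as the unital associative algebra generated by L
   subject to the relations above. *)
Record is_enveloping (K : fieldType) (G : groupType) (eps : G -> G -> K)
    (L : lmodType K) (L_ : G -> L -> Prop) (br : L -> L -> L)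
    (U : algType K) (iota : {linear L -> U}) : Prop := {
  env_rel : color_relations eps L_ br iota;
  env_univ : forall (A : algType K) (f : {linear L -> A}),
    color_relations eps L_ br f ->
    exists F : {lrmorphism U -> A},
      (forall x, F (iota x) = f x) /\
      (forall F' : {lrmorphism U -> A},
         (forall x, F' (iota x) = f x) -> F' =1 F)
}.

Section EnvelopingGrading.
Variables (K : fieldType) (G : groupType) (L : lmodType K).
Variables (L_ : G -> L -> Prop) (U : algType K) (iota : {linear L -> U}).

(* U_g is spanned by the products of homogeneous elements of L whose degrees
   have product g. *)
Inductive env_grade : G -> U -> Prop :=
| env_grade1 : env_grade 1%g 1
| env_gradeM h g x u : L_ h x -> env_grade g u ->
    env_grade (h * g)%g (iota x * u)
| env_grade0 g : env_grade g 0
| env_gradeP g (a : K) u v : env_grade g u -> env_grade g v ->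
    env_grade g (a *: u + v).

End EnvelopingGrading.

Section Martindale.
Variables (R Q : nzRingType) (j : {rmorphism R -> Q}).

Record nonzero_ideal (I : R -> Prop) : Prop := {
  idealB : forall a b, I a -> I b -> I (a - b);
  idealMl : forall r a, I a -> I (r * a);
  idealMr : forall r a, I a -> I (a * r);
  ideal_neq0 : exists2 a, I a & a != 0
}.

Definition left_hom_on (I : R -> Prop) (f : R -> R) : Prop :=
  (forall a b, I a -> I b -> f (a + b) = f a + f b) /\
  (forall r a, I a -> f (r * a) = r * f a).

(* Q is the direct limit of the groups Hom_R(I, R) of left R-module maps, I
   running over the nonzero ideals of R, with maps written on the right: each q
   is the class of a |-> a q on some I, every f is such a map, and maps that
   agree on a nonzero ideal are identified. The ring R is necessarily prime. *)
Record is_left_martindale : Prop := {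
  lmart_inj : injective j;
  lmart_frac : forall q, exists2 I, nonzero_ideal I &
    forall a, I a -> exists r, j a * q = j r;
  lmart_hom : forall I f, nonzero_ideal I -> left_hom_on I f ->
    exists q, forall a, I a -> j a * q = j (f a);
  lmart_eq0 : forall q I, nonzero_ideal I ->
    (forall a, I a -> j a * q = 0) -> q = 0
}.

Definition symmetric_elt (q : Q) : Prop :=
  exists2 J, nonzero_ideal J &
    forall a, J a -> (exists r, j a * q = j r) /\ (exists r, q * j a = j r).

Definition in_N (w : Q) : Prop :=
  (forall r, exists r', w * j r = j r' * w) /\
  (forall r, exists r', j r * w = w * j r').

Definition ring_automorphism (s : R -> R) : Prop :=
  [/\ bijective s, forall a b, s (a + b) = s a + s b,
      forall a b, s (a * b) = s a * s b & s 1 = 1].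

Definition induces (w : Q) (s : R -> R) : Prop :=
  [/\ w != 0, in_N w, ring_automorphism s & forall r, j (s r) * w = w * j r].

Definition X_inner (s : R -> R) : Prop := exists w, induces w s.

End Martindale.

(* Q is the subring of symmetric elements of a left Martindale quotient ring
   of R. *)
Definition is_symmetric_martindale (R Q : nzRingType) (j : {rmorphism R -> Q}) :
    Prop :=
  exists (Ql : nzRingType) (jl : {rmorphism R -> Ql}) (t : {rmorphism Q -> Ql}),
    [/\ is_left_martindale jl, injective t, forall r, t (j r) = jl r
      & forall p, symmetric_elt jl p <-> exists q, t q = p].

Section SemiInvariants.
Variables (K : fieldType) (G : groupType) (eps : G -> G -> K).
Variables (L : lmodType K) (L_ : G -> L -> Prop).
Variables (U : algType K) (iota : {linear L -> U}).
Variables (Q : algType K) (j : {lrmorphism U -> Q}).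

(* Phi is the automorphism of Q that extends phi_k, the automorphism of U
   acting on each U_g as eps k g; there is exactly one such Phi. *)
Definition extends_phi (k : G) (Phi : {rmorphism Q -> Q}) : Prop :=
  bijective Phi /\
  forall g u, env_grade L_ iota g u -> Phi (j u) = j (eps k g *: u).

Definition Q_grade (g : G) (q : Q) : Prop :=
  forall k, exists2 Phi, extends_phi k Phi & Phi q = eps k g *: q.

(* The value at q in Q_g of delta_x, for x in L_h. *)
Definition delta (h : G) (x : L) (g : G) (q : Q) : Q :=
  j (iota x) * q - eps h g *: (q * j (iota x)).

Definition homogeneous_semi_invariant (q : Q) : Prop :=
  exists2 g, Q_grade g q &
    forall h x, L_ h x -> exists a : K, delta h x g q = a *: q.

End SemiInvariants.

(* Main.v *)
Require Import Defs.
From HB Require Import structures.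
From mathcomp Require Import all_boot all_algebra.
From mathcomp Require Import finmap boolp wochoice monalg ring.

Set Implicit Arguments.
Unset Strict Implicit.
Unset Printing Implicit Defensive.

Import GRing.Theory.
Local Open Scope ring_scope.

(** The theorem is proved by comparing leading terms in U.

    A totally ordered homogeneous basis of L (color_basis_exists) gives U a
    basis of ordered monomials. It is found by letting L act on the free module
    on these monomials; the relations of U hold there by the color Jacobi
    identity (respectsP, coefK). Reordering a product of basis elements rescales
    it and adds shorter monomials, so up to shorter monomials U is a polynomial
    ring that commutes up to the values of eps. Hence leading monomials
    multiply (leadM), U is a domain, degrees add up (degU_mul), and a
    homogeneous element commutes with the elements of L up to eps and lower
    degree (degU_comm). As the grading is proper, the factors eps that an element
    picks up when it moves past L determine its degree in G
    (degree_separated), and this forces every nonzero ideal of U to contain a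
    nonzero homogeneous element (ideal_homogeneous).

    Let now q in Q induce an automorphism, with inverse tau: r q = q tau(r) for r
    in U. The ideal of the denominators of q contains a homogeneous a, say of
    degree g; put b = a q. Then a s b = b tau(s) tau(a) for all s in U
    (intertwines). For s = 1 this says that a and tau(a) have the same degree.
    For s = x in L of degree h it says that x b and b tau(x) agree in top degree,
    up to a scalar. The leading monomial of tau(x) is therefore x, for any order
    on the basis and for its opposite, and so tau(x) = c x + c'. The top part of
    b determines c: there is one m in G such that c = eps(h, m) for all x.
    Applying tau to the relations of U gives c' = 0 unless h = 1, so tau commutes
    with the automorphisms phi_k that define the grading. Hence
    phi_k(b) - eps(k, g m) b satisfies the same identity as b; but if it were not
    0, its leading monomial would have degree g m in G, a degree whose monomials
    it does not contain. So b is homogeneous (intertwiner_homogeneous), and then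
    so is q; the equation x q = q tau(x) says that q is a semi-invariant.
    Conversely, a homogeneous semi-invariant can be moved past the elements of
    L, hence past U. This is (2).

    For (1), two automorphisms of the form found for tau commute on generators:
    constants occur only where the factors eps are 1. For (3), nonzero
    normalizing elements are invertible in Q, and by (1) their commutators induce
    the identity, so that these commutators are central in Q. *)

(** * Bicharacters *)

Section Bicharacter.
Variables (K : fieldType) (G : groupType) (eps : G -> G -> K).
Hypothesis eps_bichar : alternating_bicharacter eps.

Lemma bicharMl g h k : eps (g * h)%g k = eps g k * eps h k.
Proof.
by rewrite (bicharV eps_bichar) (bicharM eps_bichar) invfM -!(bicharV eps_bichar).
Qed.
Lemma bicharC g h : eps g h * eps h g = 1.
Proof. by rewrite (bicharV eps_bichar) mulVf ?(bichar_neq0 eps_bichar). Qed.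
Lemma bichar1r g : eps g 1%g = 1.
Proof.
apply: (mulfI (bichar_neq0 eps_bichar g 1%g)).
by rewrite -(bicharM eps_bichar) mulg1 mulr1.
Qed.
Lemma bicharVr g h : eps g h^-1%g = (eps g h)^-1.
Proof.
apply: (mulfI (bichar_neq0 eps_bichar g h)).
by rewrite -(bicharM eps_bichar) mulgV bichar1r mulfV ?(bichar_neq0 eps_bichar).
Qed.

Lemma bichar1l g : eps 1%g g = 1.
Proof. by rewrite (bicharV eps_bichar) bichar1r invr1. Qed.
Lemma bicharVl g h : eps g^-1%g h = (eps g h)^-1.
Proof. by rewrite (bicharV eps_bichar) bicharVr -(bicharV eps_bichar g h). Qed.

End Bicharacter.

(** * The algebra of endomorphisms *)

Section Endomorphisms.
Variables (K : fieldType) (V : lmodType K).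

Definition endo := {f : V -> V | `[< linear f >]}.

HB.instance Definition _ := gen_eqMixin endo.
HB.instance Definition _ := gen_choiceMixin endo.

Implicit Types f g : endo.

Lemma endo_linear f : linear (val f).
Proof. by apply/asboolP; apply: (valP f). Qed.

Definition mk_endo (f : V -> V) (fL : linear f) : endo :=
  exist _ f (asboolT fL).

Lemma endoP f g : val f =1 val g -> f = g.
Proof. by move=> fg; apply: val_inj; apply/funext. Qed.

Lemma endo0 f : val f 0 = 0.
Proof. 
have := endo_linear f (-1) 0 0; rewrite scaler0 addr0 scaleN1r => {1}->.
by rewrite addNr.
Qed.
Lemma endoD f u v : val f (u + v) = val f u + val f v.
Proof. by have := endo_linear f 1 u v; rewrite !scale1r. Qed.
Lemma endoZ f a u : val f (a *: u) = a *: val f u.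
Proof. by have := endo_linear f a u 0; rewrite !addr0 endo0 addr0. Qed.

Fact endo_zero_subproof : linear (fun _ : V => 0 : V).
Proof. by move=> a u v; rewrite scaler0 addr0. Qed.
Fact endo_add_subproof f g : linear (fun v => val f v + val g v).
Proof. by move=> a u v; rewrite !endo_linear scalerDr addrACA. Qed.
Fact endo_opp_subproof f : linear (fun v => - val f v).
Proof. by move=> a u v; rewrite endo_linear opprD scalerN. Qed.
Fact endo_scale_subproof (b : K) f : linear (fun v => b *: val f v).
Proof. by move=> a u v; rewrite endo_linear scalerDr !scalerA mulrC. Qed.
Fact endo_one_subproof : linear (fun v : V => v).
Proof. by []. Qed.
Fact endo_mul_subproof f g : linear (fun v => val f (val g v)).
Proof. by move=> a u v; rewrite !endo_linear. Qed.

Definition endo_zero := mk_endo endo_zero_subproof.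
Definition endo_add f g := mk_endo (endo_add_subproof f g).
Definition endo_opp f := mk_endo (endo_opp_subproof f).
Definition endo_scale b f := mk_endo (endo_scale_subproof b f).
Definition endo_one := mk_endo endo_one_subproof.
Definition endo_mul f g := mk_endo (endo_mul_subproof f g).

Fact endo_addA : associative endo_add.
Proof. by move=> f g h; apply: endoP => v /=; rewrite addrA. Qed.
Fact endo_addC : commutative endo_add.
Proof. by move=> f g; apply: endoP => v /=; rewrite addrC. Qed.
Fact endo_add0 : left_id endo_zero endo_add.
Proof. by move=> f; apply: endoP => v /=; rewrite add0r. Qed.
Fact endo_addN : left_inverse endo_zero endo_opp endo_add.
Proof. by move=> f; apply: endoP => v /=; rewrite addNr. Qed.
HB.instance Definition _ :=
  GRing.isZmodule.Build endo endo_addA endo_addC endo_add0 endo_addN.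

Fact endo_mulA : associative endo_mul.
Proof. by move=> f g h; apply: endoP. Qed.
Fact endo_mul1l : left_id endo_one endo_mul.
Proof. by move=> f; apply: endoP. Qed.
Fact endo_mul1r : right_id endo_one endo_mul.
Proof. by move=> f; apply: endoP. Qed.
Fact endo_mulDl : left_distributive endo_mul +%R.
Proof. by move=> f g h; apply: endoP. Qed.
Fact endo_mulDr : right_distributive endo_mul +%R.
Proof. by move=> f g h; apply: endoP => v; rewrite /= endoD. Qed.
HB.instance Definition _ := GRing.Zmodule_isPzRing.Build endo
  endo_mulA endo_mul1l endo_mul1r endo_mulDl endo_mulDr.

Fact endo_scaleA a b f : endo_scale a (endo_scale b f) = endo_scale (a * b) f.
Proof. by apply: endoP => v /=; rewrite scalerA. Qed.
Fact endo_scale1 : left_id 1 endo_scale.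
Proof. by move=> f; apply: endoP => v /=; rewrite scale1r. Qed.
Fact endo_scaleDr : right_distributive endo_scale +%R.
Proof. by move=> a f g; apply: endoP => v; rewrite /= scalerDr. Qed.
Fact endo_scaleDl f : {morph endo_scale^~ f : a b / a + b}.
Proof. by move=> a b; apply: endoP => v; rewrite /= scalerDl. Qed.
HB.instance Definition _ := GRing.Zmodule_isLmodule.Build K endo
  endo_scaleA endo_scale1 endo_scaleDr endo_scaleDl.

End Endomorphisms.

Section EndoAlgebra.
Variables (K : fieldType) (V : lmodType K).

(** The endomorphisms of a nonzero space form a nontrivial ring, which is what
    an algebra has to be; a witness of nontriviality is a parameter of the
    type, so that the instance can be inferred. *)
Definition endo_alg (v : V) (v_neq0 : v != 0) := endo V.

Variables (v0 : V) (v0_neq0 : v0 != 0).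
Local Notation E := (endo_alg v0_neq0).

HB.instance Definition _ := GRing.Lmodule.on E.
HB.instance Definition _ := GRing.PzRing.on E.

Fact endo_one_neq0 : (1 : E) != 0.
Proof. 
apply: contraNneq v0_neq0 => /(congr1 (fun f : endo V => val f v0)) /= v0_0.
by rewrite v0_0.
Qed.
HB.instance Definition _ := GRing.PzSemiRing_isNonZero.Build E endo_one_neq0.

Fact endo_scaleAl (a : K) (f g : E) : a *: (f * g) = (a *: f) * g.
Proof. exact: endoP. Qed.
HB.instance Definition _ := GRing.Lmodule_isLalgebra.Build K E endo_scaleAl.

Fact endo_scaleAr (a : K) (f g : E) : a *: (f * g) = f * (a *: g).
Proof. by apply: endoP => v; rewrite /= endoZ. Qed.
HB.instance Definition _ := GRing.Lalgebra_isAlgebra.Build K E endo_scaleAr.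

End EndoAlgebra.

(** * Subsets that form a group *)

Section FormsGroup.
Variables (T : Type) (op : T -> T -> T) (e : T) (S : T -> Prop).
Hypothesis opA : forall x y z, op x (op y z) = op (op x y) z.
Hypothesis op1 : forall x, S x -> op e x = x.
Hypothesis S1 : S e.
Hypothesis SM : forall x y, S x -> S y -> S (op x y).
Hypothesis SV : forall x, S x -> exists2 y, S y & op y x = e.

Definition subset_carrier : Type := {x : T | `[< S x >]}.
Local Notation C := subset_carrier.

HB.instance Definition _ := gen_eqMixin C.
HB.instance Definition _ := gen_choiceMixin C.

Definition mk_carrier x (Sx : S x) : C := exist _ x (asboolT Sx).
Lemma carrierP (x : C) : S (val x). Proof. by apply/asboolP; apply: (valP x). Qed.

Fact carrier_inv_ex (x : C) : exists y : C, op (val y) (val x) = e.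
Proof. by have [y Sy yx] := SV (carrierP x); exists (mk_carrier Sy). Qed.

Definition carrier_one : C := mk_carrier S1.
Definition carrier_mul (x y : C) : C := mk_carrier (SM (carrierP x) (carrierP y)).
Definition carrier_inv (x : C) : C := sval (cid (carrier_inv_ex x)).

Fact carrier_mulA : associative carrier_mul.
Proof. by move=> x y z; apply: val_inj; apply: opA. Qed.
Fact carrier_mul1 : left_id carrier_one carrier_mul.
Proof. by move=> x; apply: val_inj; apply: op1; apply: carrierP. Qed.
Fact carrier_mulV : left_inverse carrier_one carrier_inv carrier_mul.
Proof. by move=> x; apply: val_inj; apply: (svalP (cid (carrier_inv_ex x))). Qed.
Fact carrier_mulrV : right_inverse carrier_one carrier_inv carrier_mul.
Proof. 
move=> x; rewrite -[LHS]carrier_mul1 -{1}(carrier_mulV (carrier_inv x)).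
by rewrite -carrier_mulA [X in carrier_mul _ X]carrier_mulA carrier_mulV
           carrier_mul1 carrier_mulV.
Qed.
Fact carrier_mulr1 : right_id carrier_one carrier_mul.
Proof.
by move=> x; rewrite -(carrier_mulV x) carrier_mulA carrier_mulrV carrier_mul1.
Qed.
HB.instance Definition _ := isGroup.Build C
  carrier_mulA carrier_mul1 carrier_mulr1 carrier_mulV carrier_mulrV.

(** The property P is checked on an arbitrary group that represents S, which
    keeps the carrier built here out of sight. *)
Lemma forms_group_subset (P : groupType -> Prop) :
  (forall (H : groupType) (f : H -> T), injective f -> f 1%g = e ->
     (forall x y, f (x * y)%g = op (f x) (f y)) -> (forall x, S (f x)) -> P H) ->
  forms_group op e S P.
Proof. 
move=> PH; have injv : injective (val : C -> T) by exact: val_inj.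
exists C, val; split=> //; last first.
  by apply: (PH C val) => // x; apply: carrierP.
move=> t; split=> [St | [x <-]]; last exact: carrierP.
by exists (mk_carrier St).
Qed.

End FormsGroup.

(** * Free modules *)

(** Basis vectors and linear extensions are locked, and so is the action on
    monomials below: conversion between them never has to look at the finitely
    supported functions that represent them. *)
HB.lock Definition basis_vector (K : fieldType) (T : choiceType) (k : T) : {malg K[T]} :=
  << k >>.
Canonical basis_vector_unlockable := Unlockable basis_vector.unlock.
Arguments basis_vector {K T} k.
Local Notation "<< k >>" := (basis_vector k) : ring_scope.

Lemma mcoeff_basis (K : fieldType) (T : choiceType) (k l : T) :
  (basis_vector k : {malg K[T]})@_l = (k == l)%:R.
Proof. by rewrite unlock mcoeffU. Qed.
Lemma msupp_basis (K : fieldType) (T : choiceType) (k : T) :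
  msupp (basis_vector k : {malg K[T]}) = [fset k]%fset.
Proof. by rewrite unlock msuppU oner_eq0. Qed.

HB.lock Definition lin_ext (K : fieldType) (T : choiceType) (V : lmodType K)
  (f : T -> V) (p : {malg K[T]}) : V := \sum_(k <- msupp p) p@_k *: f k.
Canonical lin_ext_unlockable := Unlockable lin_ext.unlock.

Section LinearExtension.
Variables (K : fieldType) (T : choiceType) (V : lmodType K).
Implicit Types (p q : {malg K[T]}) (f : T -> V).

Lemma lin_extEw f p (d : {fset T}) : (msupp p `<=` d)%fset ->
  lin_ext f p = \sum_(k <- d) p@_k *: f k.
Proof.
move=> le_pd; rewrite unlock (big_fset_incl _ le_pd) //= => k _.
by move/mcoeff_outdom->; rewrite scale0r.
Qed.

Lemma lin_ext_linear f : linear (lin_ext f).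
Proof.
move=> a p q; pose d := (msupp (a *: p + q) `|` (msupp p `|` msupp q))%fset.
have dp : (msupp p `<=` d)%fset.
  by apply: fsubset_trans (fsubsetUr _ _); apply: fsubsetUl.
have dq : (msupp q `<=` d)%fset.
  by apply: fsubset_trans (fsubsetUr _ _); apply: fsubsetUr.
rewrite (lin_extEw f dp) (lin_extEw f dq) (@lin_extEw f _ d) ?fsubsetUl //.
rewrite scaler_sumr -big_split /=; apply: eq_bigr => k _.
by rewrite mcoeffD mcoeffZ scalerDl scalerA.
Qed.
HB.instance Definition _ f :=
  GRing.isLinear.Build K {malg K[T]} V *:%R (lin_ext f) (lin_ext_linear f).

Lemma lin_extU f k : lin_ext f << k >> = f k.
Proof. by rewrite [lin_ext]unlock msupp_basis big_seq_fset1 mcoeff_basis eqxx scale1r. Qed.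

Lemma eq_lin_ext f g p : {in msupp p, f =1 g} -> lin_ext f p = lin_ext g p.
Proof. by move=> fg; rewrite unlock; apply: eq_big_seq => k kp; rewrite fg. Qed.

Lemma lin_ext_addf f g p a :
  lin_ext (fun k => a *: f k + g k) p = a *: lin_ext f p + lin_ext g p.
Proof.
rewrite unlock scaler_sumr -big_split /=; apply: eq_bigr => k _.
by rewrite scalerDr !scalerA mulrC.
Qed.

End LinearExtension.

Lemma malg_span (K : fieldType) (T : choiceType) (p : {malg K[T]}) :
  p = lin_ext (fun k => << k >>) p.
Proof.
rewrite [lin_ext]unlock [LHS]monalgE; apply: eq_bigr => k _.
by apply/malgP => l; rewrite mcoeffZ mcoeff_basis mcoeffU mulr_natr.
Qed.

(** These three serve bare functions that satisfy linear without carrying a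
    canonical structure. *)
Lemma linear0_of (K : fieldType) (V V' : lmodType K) (F : V -> V') :
  linear F -> F 0 = 0.
Proof.
by move=> FL; have := FL (-1) 0 0; rewrite scaler0 addr0 scaleN1r => {1}->;
   rewrite addNr.
Qed.
Lemma linearZ_of (K : fieldType) (V V' : lmodType K) (F : V -> V') a u :
  linear F -> F (a *: u) = a *: F u.
Proof. by move=> FL; have := FL a u 0; rewrite (linear0_of FL) !addr0. Qed.
Lemma linearD_of (K : fieldType) (V V' : lmodType K) (F : V -> V') u v :
  linear F -> F (u + v) = F u + F v.
Proof. by move=> FL; have := FL 1 u v; rewrite !scale1r. Qed.

Lemma lin_ext_comp (K : fieldType) (T : choiceType) (V V' : lmodType K)
    (F : V -> V') (f : T -> V) (p : {malg K[T]}) :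
  linear F -> F (lin_ext f p) = lin_ext (F \o f) p.
Proof.
move=> FL; rewrite unlock.
rewrite (big_morph F (fun u v => linearD_of u v FL) (linear0_of FL)).
by apply: eq_bigr => k _; rewrite linearZ_of.
Qed.

Lemma linear_malg_ext (K : fieldType) (T : choiceType) (V : lmodType K)
    (F F' : {malg K[T]} -> V) (p : {malg K[T]}) :
  linear F -> linear F' ->
  {in msupp p, forall k, F << k >> = F' << k >>} -> F p = F' p.
Proof.
move=> FL F'L FF'; rewrite [p]malg_span !lin_ext_comp //.
exact: eq_lin_ext.
Qed.

(** * Straightening *)

(** A totally ordered homogeneous basis of an even Lie color algebra, with its
    degrees d and its coordinate functions cd. *)
Record color_basis (K : fieldType) (G : groupType) (eps : G -> G -> K)
    (L : lmodType K) (L_ : G -> L -> Prop) (br : L -> L -> L) (I : choiceType)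
    (le : rel I) (e : I -> L) (d : I -> G) (cd : L -> {malg K[I]}) : Prop := {
  cb_total : total le;
  cb_trans : transitive le;
  cb_anti : antisymmetric le;
  cb_hom : forall i, L_ (d i) (e i);
  cb_linear : linear cd;
  cb_coordK : forall i, cd (e i) = << i >>;
  cb_span : forall z, z = lin_ext e (cd z);
  cb_coord_deg : forall g z i, L_ g z -> i \in msupp (cd z) -> d i = g;
  cb_eps1 : forall i, eps (d i) (d i) = 1;
  cb_br0 : forall i, br (e i) (e i) = 0
}.

Section Straightening.
Variables (K : fieldType) (G : groupType).
Variables (eps : G -> G -> K) (eps_bichar : alternating_bicharacter eps).
Variables (L : lmodType K) (L_ : G -> L -> Prop) (br : L -> L -> L).
Hypothesis L_color : lie_color_algebra eps L_ br.
Variables (I : choiceType) (le : rel I) (e : I -> L) (d : I -> G).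
Variable cd : L -> {malg K[I]}.
Hypothesis L_basis : color_basis eps L_ br le e d cd.

Let le_total := cb_total L_basis.
Let le_trans := cb_trans L_basis.
Let le_anti := cb_anti L_basis.
Let cd_linear := cb_linear L_basis.

(** A multiset of basis indices, represented by its sorted word. *)
Definition monomial : choiceType :=
  Choice.clone {s : seq I | sorted le s} _.
Local Notation W := monomial.
Local Notation P := {malg K[W]}.

Definition sort_word (s : seq I) : W :=
  exist (fun s => sorted le s) (sort le s) (sort_sorted le_total s).

Lemma sort_word_perm s t : perm_eq s t -> sort_word s = sort_word t.
Proof. by move=> st; apply: val_inj; apply/perm_sortP. Qed.
Lemma perm_sort_word s : perm_eq (val (sort_word s)) s.
Proof. by rewrite /= perm_sort. Qed.
Lemma sort_word_eq s t : sort_word s = sort_word t -> perm_eq s t.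
Proof. by move/(congr1 val) => /perm_sortP; apply. Qed.
Lemma size_sort_word s : size (val (sort_word s)) = size s.
Proof. exact: size_sort. Qed.
Lemma sort_wordK (w : W) : sort_word (val w) = w.
Proof. by apply: val_inj; apply: sorted_sort (valP w). Qed.

Definition eps_deg i j := eps (d i) (d j).

(** The product of e i with a sorted word, in the basis of sorted words: with
    i > j it follows the rule e_i e_j = eps e_j e_i + [e_i, e_j]. The
    intermediate product e_i t contains words that are longer than t, but they
    start with letters not below j, so that multiplying them by e_j is a mere
    concatenation; on the other words the recursion applies. This is why the
    recursion is on a bound n for the length. *)
Fixpoint act_word (n : nat) (s : seq I) (i : I) : P :=
  if n isn't n'.+1 then << sort_word [:: i] >> else
  if (size s <= n')%N then act_word n' s i else
  if s isn't j :: t then 0 else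
  if le i j then << sort_word (i :: s) >> else
    eps_deg i j *: lin_ext (fun w : W => if (size (val w) <= n')%N then act_word n' (val w) j
                                else << sort_word (j :: val w) >>) (act_word n' t i)
    + lin_ext (act_word n' t) (cd (br (e i) (e j))).

Lemma act_word_cons j t i : act_word (size t).+1 (j :: t) i =
  if le i j then << sort_word (i :: j :: t) >> else
    eps_deg i j *: lin_ext (fun w : W => if (size (val w) <= size t)%N
                                then act_word (size t) (val w) j
                                else << sort_word (j :: val w) >>) (act_word (size t) t i)
    + lin_ext (act_word (size t) t) (cd (br (e i) (e j))).
Proof. by rewrite [LHS]/= ltnn. Qed.

Fact gen_act_spec : {gen_act : I -> P -> P |
  forall i p, gen_act i p = lin_ext (fun w : W => act_word (size (val w)) (val w) i) p}.
Proof. by exists (fun i => lin_ext (fun w : W => act_word (size (val w)) (val w) i)). Qed.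
Definition gen_act := sval gen_act_spec.
Lemma gen_actE i p : gen_act i p = lin_ext (fun w : W => act_word (size (val w)) (val w) i) p.
Proof. exact: (svalP gen_act_spec). Qed.

Definition lie_act (z : L) (p : P) : P := lin_ext (gen_act^~ p) (cd z).

Lemma gen_act_linear i : linear (gen_act i).
Proof. by move=> a p p'; rewrite !gen_actE; apply: lin_ext_linear. Qed.

Lemma gen_actP i a p p' : gen_act i (a *: p + p') = a *: gen_act i p + gen_act i p'.
Proof. exact: gen_act_linear. Qed.

Lemma lie_act_linear z : linear (lie_act z).
Proof.
move=> a p p'; rewrite /lie_act.
transitivity (lin_ext (fun k => a *: gen_act k p + gen_act k p') (cd z)).
  by apply: eq_lin_ext => k _; apply: gen_act_linear.
exact: lin_ext_addf.
Qed.

Lemma lie_actP z a p p' : lie_act z (a *: p + p') = a *: lie_act z p + lie_act z p'.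
Proof. exact: lie_act_linear. Qed.

Lemma lie_act_linearl p : linear (lie_act^~ p).
Proof. by move=> a z z'; rewrite /lie_act cd_linear; apply: lin_ext_linear. Qed.

Lemma lie_act_lin a z z' p : lie_act (a *: z + z') p = a *: lie_act z p + lie_act z' p.
Proof. exact: lie_act_linearl. Qed.

Lemma lie_act_gen i p : lie_act (e i) p = gen_act i p.
Proof. by rewrite /lie_act (cb_coordK L_basis) lin_extU. Qed.

Lemma act_word_size n s i : (size s <= n)%N -> act_word n s i = act_word (size s) s i.
Proof.
elim: n s => [|n IHn] s; first by case: s.
rewrite leq_eqVlt => /orP[/eqP-> //|]; rewrite ltnS => sn /=.
by rewrite sn IHn.
Qed.

Lemma gen_actU i (w : W) : gen_act i << w >> = act_word (size (val w)) (val w) i.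
Proof. by rewrite gen_actE lin_extU. Qed.

(** ** The shape of the operators *)

Definition size_le n (p : P) : Prop :=
  forall w, w \in msupp p -> (size (val w) <= n)%N.

Lemma size_leP n p :
  size_le n p <-> forall w, (n < size (val w))%N -> p@_w = 0.
Proof.
split=> [lp w nw | lp w]; last first.
  by rewrite -mcoeff_neq0 leqNgt; apply: contraNN => nw; rewrite lp.
by apply/eqP; rewrite mcoeff_eq0; apply: contraL nw => /lp; rewrite leqNgt.
Qed.

Lemma size_le_lin n a p p' : size_le n p -> size_le n p' -> size_le n (a *: p + p').
Proof.
move=> /size_leP lp /size_leP lp'; apply/size_leP => w nw.
by rewrite mcoeffD mcoeffZ lp // lp' // mulr0 addr0.
Qed.
Lemma size_le0 n : size_le n 0. Proof. by apply/size_leP => w _; rewrite mcoeff0. Qed.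
Lemma size_leD n p p' : size_le n p -> size_le n p' -> size_le n (p + p').
Proof. by rewrite -{2}(scale1r p); apply: size_le_lin. Qed.
Lemma size_leZ n a p : size_le n p -> size_le n (a *: p).
Proof. by move=> lp; rewrite -[X in size_le _ X]addr0; apply: size_le_lin lp (size_le0 n). Qed.
Lemma size_leU n w : (size (val w) <= n)%N -> size_le n << w >>.
Proof. by move=> wn v; rewrite msupp_basis in_fset1 => /eqP->. Qed.
Lemma size_leW n m p : (n <= m)%N -> size_le n p -> size_le m p.
Proof. by move=> nm lp w /lp/leq_trans; apply. Qed.
Lemma size_le_lin_ext n (T : choiceType) (f : T -> P) (p : {malg K[T]}) :
  (forall k, k \in msupp p -> size_le n (f k)) -> size_le n (lin_ext f p).
Proof.
move=> lf; rewrite unlock big_seq.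
elim/big_ind: _ => [|x y|k /lf]; [exact: size_le0 | exact: size_leD | exact: size_leZ].
Qed.

(** Up to smaller monomials and to a nonzero scalar, gen_act i multiplies by i. *)
Definition inserts i (w : W) : Prop := exists s (r : P),
  [/\ s != 0, size_le (size (val w)) r & gen_act i << w >> = s *: << sort_word (i :: val w) >> + r].

Lemma gen_act_le i (w : W) : all (le i) (val w) -> gen_act i << w >> = << sort_word (i :: val w) >>.
Proof.
rewrite gen_actU; case: w => [[|j t] jt] //= /andP[ij _]; rewrite ltnn ij.
by congr << _ >>.
Qed.

Lemma inserts_size_le n i p : 
  (forall w, (size (val w) <= n)%N -> inserts i w) -> size_le n p -> size_le n.+1 (gen_act i p).
Proof.
move=> Hn lp; rewrite gen_actE; apply: size_le_lin_ext => w /lp wn; rewrite -gen_actU.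
have [s [r [_ lr ->]]] := Hn w wn.
apply: size_le_lin; first by apply: size_leU; rewrite size_sort_word.
by apply: size_leW lr; apply: ltnW.
Qed.

Lemma eps_deg_neq0 i j : eps_deg i j != 0. Proof. exact: bichar_neq0. Qed.

(** The two cases of the definition of act_word amount to one formula once the
    words longer than t in the support of e_i t are known: there is just one,
    the sorted word of i and t. *)
Lemma gen_act_gt_of i j (w t : W) : val w = j :: val t -> ~~ le i j -> inserts i t ->
  gen_act i << w >> = eps_deg i j *: gen_act j (gen_act i << t >>) + lie_act (br (e i) (e j)) << t >>.
Proof.
move=> def_w nij [s [r [_ lr Xt]]].
have jt_sorted := valP w.
rewrite [LHS]gen_actU def_w act_word_cons (negPf nij); congr (_ *: _ + _); last first.
  by apply: eq_lin_ext => k _; rewrite gen_actU.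
rewrite -(gen_actU i t) (gen_actE j); apply: eq_lin_ext => v; rewrite Xt => vX.
case: ifP => [vn | nvn]; first by rewrite act_word_size.
have v_it : v = sort_word (i :: val t).
  apply: contraNeq (negbT nvn) => ne_v; apply: lr.
  move: vX; rewrite -!mcoeff_neq0 mcoeffD mcoeffZ mcoeff_basis [sort_word _ == _]eq_sym (negPf ne_v).
  by rewrite mulr0 add0r.
rewrite -gen_actU gen_act_le // v_it; apply/allP => k; rewrite (perm_mem (perm_sort_word _)).
rewrite inE => /orP[/eqP-> | kt]; first by have := le_total i j; rewrite (negPf nij).
by move: jt_sorted; rewrite def_w /= (path_sortedE le_trans) => /andP[/allP->].
Qed.

(** Induction on the length: in the formula for i > j, the factor j commutes
    with the insertion of i, and everything else is shorter. *)
Lemma gen_act_inserts i (w : W) : inserts i w.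
Proof.
have [n] := ubnP (size (val w)); elim: n i w => // n IHn i w.
rewrite ltnS => wn; case def_w: (val w) => [|j t].
  exists 1, 0; split; rewrite ?oner_eq0 //; first exact: size_le0.
  by rewrite gen_act_le ?def_w // scale1r addr0.
have [ij | nij] := boolP (le i j).
  exists 1, 0; split; rewrite ?oner_eq0 //; first exact: size_le0.
  rewrite gen_act_le ?scale1r ?addr0 //.
  rewrite def_w /= ij /=; have := valP w; rewrite def_w /=.
  rewrite (path_sortedE le_trans) => /andP[/allP jt _].
  by apply/allP => k /jt; apply: le_trans.
have t_sorted : sorted le t.
  by have := valP w; rewrite def_w => /path_sorted.
pose t' : W := exist (fun s => sorted le s) t t_sorted.
have jt' : val w = j :: val t' by [].
have tn : (size t < n)%N by move: wn; rewrite def_w.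
have [s [r [s0 lr Xt]]] := IHn i t' tn.
have rec_t v k : (size (val v) <= size t)%N -> inserts k v.
  by move=> vt; apply: IHn; apply: leq_ltn_trans tn.
have lXt k : size_le (size t).+1 (gen_act k << t' >>).
  by apply: inserts_size_le (size_leU (leqnn _)) => v vt; apply: rec_t.
have lXr : size_le (size t).+1 (gen_act j r).
  by apply: inserts_size_le lr => v vt; apply: rec_t.
rewrite /inserts (gen_act_gt_of jt' nij (IHn i t' tn)) Xt gen_actP scalerDr scalerA.
have -> : gen_act j << sort_word (i :: val t') >> = << sort_word (i :: val w) >>.
  rewrite gen_act_le.
    congr << _ >>; rewrite def_w; apply: sort_word_perm.
    apply: (@perm_trans _ (j :: i :: t)); first by rewrite perm_cons perm_sort_word.
    by rewrite -[_ :: _ :: _]/([:: j] ++ [:: i] ++ t) perm_catCA.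
  apply/allP => k; rewrite (perm_mem (perm_sort_word _)) inE => /orP[/eqP-> | kt].
    by have := le_total i j; rewrite (negPf nij).
  have := valP w; rewrite def_w /= (path_sortedE le_trans) => /andP[/allP jt _].
  exact: jt.
exists (eps_deg i j * s), (eps_deg i j *: gen_act j r + lie_act (br (e i) (e j)) << t' >>).
split; first by rewrite mulf_neq0 ?eps_deg_neq0.
  rewrite def_w; apply: size_le_lin => //.
  by apply: size_le_lin_ext => k _; apply: lXt.
by rewrite addrA.
Qed.

Lemma gen_act_gt i j (w t : W) : val w = j :: val t -> ~~ le i j ->
  gen_act i << w >> = eps_deg i j *: gen_act j (gen_act i << t >>) + lie_act (br (e i) (e j)) << t >>.
Proof. by move=> wt ij; apply: gen_act_gt_of (gen_act_inserts _ _). Qed.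

Lemma gen_act_size_le n i p : size_le n p -> size_le n.+1 (gen_act i p).
Proof. by apply: inserts_size_le => w _; apply: gen_act_inserts. Qed.

Lemma lie_act_size_le n z p : size_le n p -> size_le n.+1 (lie_act z p).
Proof. by move=> lp; apply: size_le_lin_ext => k _; apply: gen_act_size_le. Qed.

(** ** The defining relations *)

Lemma eps_degK i j : eps_deg i j * eps_deg j i = 1.
Proof. by rewrite {2}/eps_deg (bicharV eps_bichar) mulfV ?eps_deg_neq0. Qed.

(** Relations that involve the degree of x only have to be checked on the basis
    elements of that degree, since coordinates respect the grading. *)
Lemma homogeneous_ext (V : lmodType K) (F F' : L -> V) g x :
  linear F -> linear F' -> (forall i, d i = g -> F (e i) = F' (e i)) ->
  L_ g x -> F x = F' x.
Proof.
move=> FL F'L FF' gx; rewrite (cb_span L_basis x) !lin_ext_comp //.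
by apply: eq_lin_ext => i /(cb_coord_deg L_basis gx)/FF'.
Qed.

Definition respects g h x y (p : P) : Prop :=
  lie_act x (lie_act y p) = eps g h *: lie_act y (lie_act x p) + lie_act (br x y) p.

Lemma respects_lin g h x y a p p' :
  respects g h x y p -> respects g h x y p' -> respects g h x y (a *: p + p').
Proof.
rewrite /respects => Hp Hp'; rewrite !lie_actP Hp Hp' !scalerDr !scalerA (mulrC a).
by rewrite addrACA.
Qed.

Lemma respects_ext n g h x y (p : P) :
  (forall i j w, (size (val w) < n)%N -> respects (d i) (d j) (e i) (e j) << w >>) ->
  L_ g x -> L_ h y -> (forall w, w \in msupp p -> (size (val w) < n)%N) ->
  respects g h x y p.
Proof.
move=> Hn gx hy lp; rewrite /respects.
apply: (@linear_malg_ext _ _ _ (fun p => lie_act x (lie_act y p))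
  (fun p => eps g h *: lie_act y (lie_act x p) + lie_act (br x y) p)) => [a u v|a u v|w /lp wn].
- by rewrite !lie_actP.
- by rewrite !lie_actP !scalerDr !scalerA (mulrC a) addrACA.
apply: (@homogeneous_ext _ (fun x => lie_act x (lie_act y << w >>))
  (fun x => eps g h *: lie_act y (lie_act x << w >>) + lie_act (br x y) << w >>) g) => //.
- by move=> a u v; rewrite lie_act_lin.
- move=> a u v; rewrite lie_act_lin lie_actP (color_linearl L_color) lie_act_lin.
  by rewrite !scalerDr !scalerA (mulrC a) addrACA.
move=> i <-.
apply: (@homogeneous_ext _ (fun y => lie_act (e i) (lie_act y << w >>))
  (fun y => eps (d i) h *: lie_act y (lie_act (e i) << w >>) + lie_act (br (e i) y) << w >>) h) => //.
- by move=> a u v; rewrite lie_act_lin lie_actP.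
- move=> a u v; rewrite lie_act_lin (color_linearr L_color) lie_act_lin.
  by rewrite !scalerDr !scalerA (mulrC a) addrACA.
by move=> j <-; apply: Hn.
Qed.

Lemma val_sort_word_cons i (w : W) : all (le i) (val w) -> val (sort_word (i :: val w)) = i :: val w.
Proof.
move=> iw; apply: sorted_sort => //=; rewrite (path_sortedE le_trans) iw.
exact: valP w.
Qed.

(** When j is below the whole word, e_j w is a sorted word, and the relation is
    the defining formula for e_i acting on it. *)
Lemma respects_le i j (w : W) : ~~ le i j -> all (le j) (val w) ->
  respects (d i) (d j) (e i) (e j) << w >>.
Proof.
move=> nij jw; rewrite /respects !lie_act_gen (gen_act_le jw).
exact: (gen_act_gt (val_sort_word_cons jw)).
Qed.

(** The linear algebra in the overlap i > j > k: with x, y, z and u standing for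
    eps_ij, eps_jk, eps_ik and eps_ji, both ways of reordering e_i e_j e_k
    agree. *)
Lemma scaler_rearrange (V : lmodType K) (x y z u : K) (a b c r f h : V) :
  x * u = 1 ->
  y *: (z *: (x *: a + b) + c) + ((x * z) *: r + f) =
  x *: (z *: (y *: a + r) + ((u * y) *: c + h)) + ((z * y) *: b + (f - x *: h)).
Proof.
move=> xu1; transitivity ((x * y * z) *: a + (y * z) *: b + y *: c
                             + (x * z) *: r + f).
  by rewrite !scalerDr !scalerA !addrA; congr (_ *: _ + _ + _ + _ + _); ring.
rewrite !scalerDr !scalerA !addrA [RHS](ACl (1*5*3*2*6*4*7))%AC /= addrK.
have -> : x * (u * y) = y by rewrite mulrA xu1 mul1r.
by congr (_ *: _ + _ *: _ + _ + _ + _); ring.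
Qed.

(** In the essential case, i > j > k where w starts with k. Both e_i e_j w and e_j e_i w
    are rewritten so that e_k comes first; the relations on shorter words apply
    to what follows, and the brackets that remain cancel by the color Jacobi
    identity. *)
Lemma respects_gt n i j (w : W) : size (val w) = n ->
  (forall g h x y p, L_ g x -> L_ h y ->
     (forall v, v \in msupp p -> (size (val v) < n)%N) -> respects g h x y p) ->
  ~~ le i j -> respects (d i) (d j) (e i) (e j) << w >>.
Proof.
move=> wn IHn nij; have [jw | njw] := boolP (all (le j) (val w)).
  exact: respects_le.
case def_w: (val w) njw => [|k t] // njw.
have kt_sorted : sorted le (k :: t) by rewrite -def_w; apply: (valP w).
have /= kt : all (le k) t.
  by move: kt_sorted; rewrite /= (path_sortedE le_trans) => /andP[].
have njk : ~~ le j k.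
  apply: contra njw => jk; rewrite /= jk; apply/allP => l /(allP kt).
  exact: le_trans.
have [kj ji] : le k j /\ le j i.
  by have := le_total j k; have := le_total i j; rewrite (negPf njk) (negPf nij).
have nik : ~~ le i k by apply: contra nij => ik; apply: le_trans ik kj.
have ki : le k i by apply: le_trans kj ji.
pose t' : W := exist (fun s => sorted le s) t (path_sorted kt_sorted).
have wt : val w = k :: val t' by [].
have tn : (size (val t') < n)%N by rewrite -wn def_w.
have lt v : v \in msupp (<< t' >> : P) -> (size (val v) < n)%N.
  by rewrite msupp_basis in_fset1 => /eqP->.
have resp_k m l : ~~ le m k -> le k l ->
    respects (d m) (d k) (e m) (e k) (gen_act l << t' >>).
  move=> nmk kl; have [s [r [_ lr ->]]] := gen_act_inserts l t'.
  apply: respects_lin; last first.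
    apply: IHn; [exact: cb_hom L_basis _ | exact: cb_hom L_basis _ |].
    by move=> v /lr vt; apply: leq_ltn_trans tn.
  apply: respects_le => //; apply/allP => b.
  by rewrite (perm_mem (perm_sort_word _)) inE => /orP[/eqP-> // | /(allP kt)].
have hom l : L_ (d l) (e l) := cb_hom L_basis l.
have hom2 l m : L_ (d l * d m)%g (br (e l) (e m)) by exact: (color_degree L_color (hom l) (hom m)).
have wk : << w >> = gen_act k << t' >> :> P.
  by rewrite gen_act_le // -wt sort_wordK.
have := IHn _ _ _ _ _ (hom i) (hom2 j k) lt.
have := IHn _ _ _ _ _ (hom j) (hom2 i k) lt.
have := IHn _ _ _ _ _ (hom i) (hom j) lt.
have := IHn _ _ _ _ _ (hom2 i j) (hom k) lt.
have := resp_k i j nik kj; have := resp_k j i njk ki.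
rewrite /respects !lie_act_gen -wk => Ejk Eik Eijk Eij Ejik Eijk'.
rewrite (gen_act_gt wt njk) (gen_act_gt wt nik) !gen_actP Eijk'.
rewrite Eik Ejk Ejik Eijk Eij gen_actP.
rewrite (color_jacobi L_color (e k) (hom i) (hom j)).
have -> : lie_act (br (e i) (br (e j) (e k))
              - eps (d i) (d j) *: br (e j) (br (e i) (e k))) << t' >> =
   lie_act (br (e i) (br (e j) (e k))) << t' >>
   - eps_deg i j *: lie_act (br (e j) (br (e i) (e k))) << t' >>.
  by rewrite -scaleNr addrC lie_act_lin scaleNr addrC.
rewrite !(bicharM eps_bichar) !(bicharMl eps_bichar) -!/(eps_deg _ _).
apply: scaler_rearrange; exact: eps_degK.
Qed.

(** The case i < j follows from j < i by antisymmetry of the bracket, and i = j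
    holds because basis elements are even: eps_ii = 1 and [e_i, e_i] = 0. *)
Lemma respectsP g h x y p : L_ g x -> L_ h y -> respects g h x y p.
Proof.
have [n] : exists n, forall w, w \in msupp p -> (size (val w) < n)%N.
  exists (\max_(w <- msupp p) size (val w)).+1 => w wp; rewrite ltnS.
  by rewrite (big_rem w wp) leq_maxl.
elim: n g h x y p => [|n IHn] g h x y p lp gx hy.
  apply: (@respects_ext 0) => //.
apply: (@respects_ext n.+1) => // i j w; rewrite ltnS leq_eqVlt => /orP[/eqP wn|wn].
  have IH g' h' x' y' p' : L_ g' x' -> L_ h' y' ->
     (forall v, v \in msupp p' -> (size (val v) < n)%N) -> respects g' h' x' y' p'.
    by move=> ? ? ?; apply: IHn.
  have [<-|neq_ij] := eqVneq i j.
    rewrite /respects (cb_br0 L_basis) (linear0_of (lie_act_linearl _)) addr0.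
    by rewrite (cb_eps1 L_basis) scale1r.
  have [ij|] := boolP (le i j); last exact: respects_gt wn IH.
  have nji : ~~ le j i.
    by apply: contra neq_ij => ji; apply/eqP/le_anti/andP.
  have := respects_gt wn IH nji; rewrite /respects !lie_act_gen -!/(eps_deg _ _) => ->.
  have -> : br (e i) (e j) = (- eps_deg i j) *: br (e j) (e i) + 0.
    rewrite addr0 scaleNr.
    exact: (color_anti L_color (cb_hom L_basis i) (cb_hom L_basis j)).
  rewrite lie_act_lin (linear0_of (lie_act_linearl _)) addr0 scaleNr scalerDr addrK scalerA.
  by rewrite eps_degK scale1r.
apply: IHn; [|exact: (cb_hom L_basis)|exact: (cb_hom L_basis)].
by move=> v; rewrite msupp_basis in_fset1 => /eqP->.
Qed.

End Straightening.

(** * Generation of the enveloping algebra *)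

Section Generation.
Variables (K : fieldType) (L : lmodType K) (U : algType K) (iota : {linear L -> U}).

Inductive env_gen : U -> Prop :=
| env_gen1 : env_gen 1
| env_gen_lin (a : K) u v : env_gen u -> env_gen v -> env_gen (a *: u + v)
| env_genM x u : env_gen u -> env_gen (iota x * u).

Lemma env_gen_mul u v : env_gen u -> env_gen v -> env_gen (u * v).
Proof.
move=> gu gv; elim: gu => [|a u1 u2 _ IH1 _ IH2|x u' _ IH].
- by rewrite mul1r.
- by rewrite mulrDl -scalerAl; apply: env_gen_lin.
- by rewrite -mulrA; apply: env_genM.
Qed.

Definition env_gen_pred : pred U := fun u => `[< env_gen u >].
Definition env_sub : Type := {u : U | env_gen_pred u}.

Fact env_gen_closed : GRing.subalg_closed env_gen_pred.
Proof.
split=> [|a u v /asboolP gu /asboolP gv|u v /asboolP gu /asboolP gv];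
  apply/asboolP; first exact: env_gen1.
  exact: env_gen_lin.
exact: env_gen_mul.
Qed.

HB.instance Definition _ := [isSub of env_sub for sval].
HB.instance Definition _ := [Choice of env_sub by <:].
HB.instance Definition _ := GRing.SubChoice_isSubAlgebra.Build K U env_gen_pred
  env_sub (GRing.subalg_closed_semi env_gen_closed).

Fact env_gen_iota x : env_gen_pred (iota x).
Proof. by apply/asboolP; rewrite -[iota x]mulr1; do 2!constructor. Qed.

Definition env_sub_iota x : env_sub := Sub (iota x) (env_gen_iota x).

Fact env_sub_iota_linear : linear env_sub_iota.
Proof. by move=> a x y; apply: val_inj; rewrite /= linearP. Qed.
HB.instance Definition _ :=
  GRing.isLinear.Build K L env_sub *:%R env_sub_iota env_sub_iota_linear.

(** The subalgebra generated by L satisfies the relations, so U retracts onto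
    it; by uniqueness the retraction followed by the inclusion is the identity. *)
Lemma env_generated (G : groupType) (eps : G -> G -> K) (L_ : G -> L -> Prop)
    (br : L -> L -> L) (S : U -> Prop) :
  is_enveloping eps L_ br iota -> S 1 ->
  (forall (a : K) u v, S u -> S v -> S (a *: u + v)) ->
  (forall x u, S u -> S (iota x * u)) -> forall u, S u.
Proof.
move=> Uenv S1 Slin SM u; suff: env_gen u.
  by elim=> [//|a v w _ + _|x v _]; [apply: Slin | apply: SM].
have rel : color_relations eps L_ br env_sub_iota.
  move=> g h x y gx hy; apply: (@val_inj _ _ env_sub).
  exact: (env_rel Uenv gx hy).
have [F [Fi _]] := env_univ Uenv (f := env_sub_iota) rel.
have [F0 [_ F0u]] := env_univ Uenv (f := iota) (env_rel Uenv).
have id_u : u = F0 u by apply: (F0u idfun).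
pose f' u := val (F u).
have f'L : linear f' by move=> a v w; rewrite /f' linearP.
have f'M : GRing.monoid_morphism f' by rewrite /f'; split=> [|v w]; rewrite ?rmorph1 ?rmorphM.
pose F' : {lrmorphism U -> U} := HB.pack f' (GRing.isLinear.Build K U U *:%R f' f'L)
  (GRing.isMonoidMorphism.Build U U f' f'M).
have <- : F' u = u.
  by rewrite [RHS]id_u; apply: F0u => x; rewrite /= /f' Fi.
by apply/asboolP; apply: (valP (F u)).
Qed.

End Generation.

(** * The Poincare-Birkhoff-Witt basis *)

Section PBW.
Variables (K : fieldType) (G : groupType).
Variables (eps : G -> G -> K) (eps_bichar : alternating_bicharacter eps).
Variables (L : lmodType K) (L_ : G -> L -> Prop) (br : L -> L -> L).
Hypothesis L_color : lie_color_algebra eps L_ br.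
Variables (I : choiceType) (le : rel I) (e : I -> L) (d : I -> G).
Variable cd : L -> {malg K[I]}.
Hypothesis L_basis : color_basis eps L_ br le e d cd.
Variables (U : algType K) (iota : {linear L -> U}).
Hypothesis U_env : is_enveloping eps L_ br iota.

Let le_total := cb_total L_basis.
Let le_trans := cb_trans L_basis.
Local Notation W := (monomial le).
Local Notation P := {malg K[W]}.
Local Notation sort_word := (sort_word L_basis).
Local Notation gen_act := (gen_act L_basis).
Local Notation lie_act := (lie_act L_basis).
Local Notation y_ i := (iota (e i)).
Local Notation mon w := (\prod_(i <- w) y_ i).

(** Left multiplication by the basis elements of L is enough to reach all of U
    from 1. *)
Lemma enveloping_ind (S : U -> Prop) : S 1 ->
  (forall (a : K) u v, S u -> S v -> S (a *: u + v)) ->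
  (forall i u, S u -> S (y_ i * u)) -> forall u, S u.
Proof.
move=> S1 Slin SM; apply: (env_generated U_env) => // x u Su.
rewrite (cb_span L_basis x) (lin_ext_comp _ _ (linearP iota)).
rewrite (lin_ext_comp (F := fun v => v * u)) => [|a v w]; last by rewrite mulrDl scalerAl.
have S0 : S 0 by have := Slin (-1) _ _ S1 S1; rewrite scaleN1r addNr.
rewrite unlock big_seq; elim/big_ind: _ => //= [v w Sv Sw|i _].
  by rewrite -[v]scale1r; apply: Slin.
by rewrite -[X in S X]addr0; apply: Slin => //; apply: SM.
Qed.

Fact one_mon_neq0 : (<< sort_word [::] >> : P) != 0.
Proof.
apply/eqP => /(congr1 (mcoeff (sort_word [::]))); rewrite mcoeff_basis eqxx mcoeff0.
by move/eqP; rewrite oner_eq0.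
Qed.

Definition lie_endo (z : L) : endo_alg one_mon_neq0 :=
  mk_endo (fun a p p' => lie_actP L_basis z a p p').
Fact lie_endo_linear : linear lie_endo.
Proof. by move=> a z z'; apply: endoP => p; apply: lie_act_lin. Qed.
HB.instance Definition _ := GRing.isLinear.Build K L (endo_alg one_mon_neq0) *:%R lie_endo lie_endo_linear.

(** The action of L on the free module on sorted words extends to U by the
    universal property; evaluating it on the empty word gives the
    coordinates. *)
Lemma coef_exists : exists c : U -> P, [/\ linear c, c 1 = << sort_word [::] >>
  & forall x u, c (iota x * u) = lie_act x (c u)].
Proof.
have rel : color_relations eps L_ br lie_endo.
  move=> g h x y gx hy; apply: endoP => p /=.
  have := respectsP eps_bichar L_color L_basis p gx hy; rewrite /respects => ->.
  by rewrite addrAC subrr add0r.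
have [F [Fi _]] := env_univ U_env (f := lie_endo) rel.
exists (fun u => sval (F u : endo P) << sort_word [::] >>); split=> [a u v||x u].
- by rewrite linearP.
- by rewrite rmorph1.
have -> : F (iota x * u) = lie_endo x * F u by rewrite -[lie_endo x]Fi -rmorphM.
by [].
Qed.

Definition coef : U -> P := sval (cid coef_exists).

Lemma coef_linear : linear coef.
Proof. by have [] := svalP (cid coef_exists). Qed.
Lemma coef1 : coef 1 = << sort_word [::] >>.
Proof. by have [] := svalP (cid coef_exists). Qed.
Lemma coef_iotaM x u : coef (iota x * u) = lie_act x (coef u).
Proof. by have [_ _] := svalP (cid coef_exists); apply. Qed.
Lemma coefM i u : coef (y_ i * u) = gen_act i (coef u).
Proof. by rewrite coef_iotaM lie_act_gen. Qed.
HB.instance Definition _ := GRing.isLinear.Build K U P *:%R coef coef_linear.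

Lemma coef_mon_sorted (w : W) : coef (mon (val w)) = << w >>.
Proof.
rewrite -[w in RHS](sort_wordK L_basis); have : sorted le (val w) := valP w.
elim: (val w) => [|i s IHs]; first by rewrite big_nil coef1.
move=> is_; rewrite big_cons coefM IHs; last exact: path_sorted is_.
have s_sorted : val (sort_word s) = s by apply: sorted_sort (path_sorted is_).
rewrite gen_act_le s_sorted //.
by move: is_; rewrite /= (path_sortedE le_trans) => /andP[].
Qed.

Definition size_lt n (p : P) := forall v, v \in msupp p -> (size (val v) < n)%N.

(** Reordering a product rescales it and adds shorter monomials. *)
Lemma coef_mon (s : seq I) : exists a (r : P),
  [/\ a != 0, size_lt (size s) r & coef (mon s) = a *: << sort_word s >> + r].
Proof.
elim: s => [|i s [a [r [a0 lr IHs]]]].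
  exists 1, 0; split; rewrite ?oner_eq0 //; first by move=> v; rewrite msupp0.
  by rewrite big_nil coef1 scale1r addr0.
rewrite big_cons coefM IHs gen_actP.
have [b [r' [b0 lr' ->]]] := gen_act_inserts eps_bichar L_basis i (sort_word s).
have -> : sort_word (i :: val (sort_word s)) = sort_word (i :: s).
  by apply: sort_word_perm; rewrite perm_cons perm_sort_word.
exists (a * b), (a *: r' + gen_act i r); split; first by rewrite mulf_neq0.
  apply: (size_le_lin (n := size s)); first by apply: size_leW lr'; rewrite size_sort_word.
  rewrite [r]malg_span (lin_ext_comp _ _ (gen_act_linear L_basis i)).
  apply: size_le_lin_ext => w /lr ws; apply: (size_leW ws).
  by apply: gen_act_size_le => //; apply: size_leU.
by rewrite scalerDr scalerA addrA.
Qed.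

Definition mon_sum (p : P) : U := lin_ext (fun w : W => mon (val w)) p.

Lemma mon_sum_linear : linear mon_sum. Proof. exact: lin_ext_linear. Qed.
HB.instance Definition _ := GRing.isLinear.Build K P U *:%R mon_sum mon_sum_linear.

Lemma mon_sumU w : mon_sum << w >> = mon (val w). Proof. exact: lin_extU. Qed.

Lemma mon_sum_gen_act_le i (w : W) : all (le i) (val w) ->
  mon_sum (gen_act i << w >>) = y_ i * mon_sum << w >>.
Proof.
move=> iw; by rewrite gen_act_le // !mon_sumU (val_sort_word_cons L_basis iw) big_cons.
Qed.

Lemma mon_sum_lie_act (p : P) z :
  (forall w i, w \in msupp p -> mon_sum (gen_act i << w >>) = y_ i * mon_sum << w >>) ->
  mon_sum (lie_act z p) = iota z * mon_sum p.
Proof.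
move=> Hp; apply: (linear_malg_ext (F := fun p => mon_sum (lie_act z p))
                                   (F' := fun p => iota z * mon_sum p)).
- by move=> a u v; rewrite lie_actP linearP.
- by move=> a u v; rewrite linearP mulrDr scalerAr.
move=> w wp.
have -> : lie_act z << w >> = lin_ext (fun i => gen_act i << w >>) (cd z) by [].
rewrite [in RHS](cb_span L_basis z) (lin_ext_comp _ _ (linearP iota)).
rewrite (lin_ext_comp (F := fun v => v * mon_sum << w >>)) => [|a u v]; last first.
  by rewrite mulrDl scalerAl.
rewrite (lin_ext_comp _ _ mon_sum_linear); apply: eq_lin_ext => i _ /=; exact: Hp.
Qed.

(** Straightening in the free module mirrors an identity of U, by induction on
    the length. The formula for i > j multiplies by e_j elements that need not
    be shorter, but their only long term is one on which e_j concatenates. *)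
Lemma mon_sum_gen_act i (w : W) : mon_sum (gen_act i << w >>) = y_ i * mon_sum << w >>.
Proof.
have [n] := ubnP (size (val w)); elim: n i w => // n IHn i w.
rewrite ltnS => wn; have [iw | niw] := boolP (all (le i) (val w)).
  exact: mon_sum_gen_act_le.
case def_w: (val w) niw => [|j t] // niw.
have jt_sorted : sorted le (j :: t) by rewrite -def_w; apply: (valP w).
have /= jt : all (le j) t.
  by move: jt_sorted; rewrite /= (path_sortedE le_trans) => /andP[].
have nij : ~~ le i j.
  apply: contra niw => ij; rewrite /= ij; apply/allP => l /(allP jt).
  exact: le_trans.
pose t' : W := exist (fun s => sorted le s) t (path_sorted jt_sorted).
have wt : val w = j :: val t' by [].
have tn : (size (val t') < n)%N by move: wn; rewrite def_w.
have psi_t z : mon_sum (lie_act z << t' >>) = iota z * mon_sum << t' >>.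
  by apply: mon_sum_lie_act => v k; rewrite msupp_basis in_fset1 => /eqP->; apply: IHn.
have psi_Xr k r : size_lt n r -> mon_sum (gen_act k r) = y_ k * mon_sum r.
  by move=> rn; rewrite -lie_act_gen; apply: mon_sum_lie_act => v l /rn; apply: IHn.
have psi_jit : mon_sum (gen_act j (gen_act i << t' >>)) = y_ j * (y_ i * mon_sum << t' >>).
  rewrite -IHn //; have [a [r [_ lr ->]]] := gen_act_inserts eps_bichar L_basis i t'.
  rewrite gen_actP !linearP mulrDr -scalerAr; congr (_ *: _ + _); last first.
    by apply: psi_Xr => v /lr vt; apply: leq_ltn_trans tn.
  apply: mon_sum_gen_act_le; apply/allP => b; rewrite (perm_mem (perm_sort_word L_basis _)) inE.
  case/orP=> [/eqP-> | /(allP jt) //].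
  by have := le_total i j; rewrite (negPf nij).
rewrite (gen_act_gt eps_bichar L_basis wt nij) mon_sum_linear psi_t psi_jit.
rewrite !mon_sumU wt big_cons !mulrA -(env_rel U_env (cb_hom L_basis i) (cb_hom L_basis j)).
by rewrite mulrBl -!scalerAl addrC subrK.
Qed.

(** With coef_mon_sorted, this is the theorem of Poincare, Birkhoff and Witt. *)
Lemma coefK : cancel coef mon_sum.
Proof.
apply: enveloping_ind => [|a u v IHu IHv|i u IHu].
- have v1 : val (sort_word [::]) = [::] by [].
  by rewrite coef1 mon_sumU v1 big_nil.
- by rewrite coef_linear mon_sum_linear IHu IHv.
rewrite coefM -[in RHS]IHu -lie_act_gen; apply: mon_sum_lie_act => w j _; exact: mon_sum_gen_act.
Qed.

Lemma mon_span u : u = lin_ext (fun w : W => mon (val w)) (coef u).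
Proof. by rewrite -[LHS]coefK. Qed.

Lemma mon_ind (S : U -> Prop) u : S 0 ->
  (forall (a : K) u v, S u -> S v -> S (a *: u + v)) ->
  (forall w, w \in msupp (coef u) -> S (mon (val w))) -> S u.
Proof.
move=> S0 Slin Smon; rewrite [u]mon_span unlock big_seq.
elim/big_ind: _ => //= [v w Sv Sw|w wu].
  by rewrite -[v]scale1r; apply: Slin.
by rewrite -[X in S X]addr0; apply: Slin => //; apply: Smon.
Qed.

End PBW.

(** * Monomial orders *)

Section MonomialOrder.
Variables (I : choiceType) (r : rel I).
Hypotheses (r_total : total r) (r_trans : transitive r) (r_anti : antisymmetric r).
Implicit Types v w s : seq I.

(** Words are compared up to permutation, through multiplicities: then
    concatenation is visibly monotone. The order r on letters is a parameter
    since an order and its opposite are both used later. *)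
Definition ltc v w : Prop := exists i, (count_mem i w < count_mem i v)%N /\
  forall j, r j i -> j != i -> count_mem j v = count_mem j w.
Definition ltw v w : Prop := (size v < size w)%N \/ size v = size w /\ ltc v w.
Definition lew v w : Prop := perm_eq v w \/ ltw v w.

Lemma ltc_trans v w s : ltc v w -> ltc w s -> ltc v s.
Proof.
move=> [i [wi eqi]] [k [sk eqk]]; have [eq_ik | neq_ik] := eqVneq i k.
  exists k; rewrite -{1 2}eq_ik; split; first by rewrite (leq_trans _ wi) // ltnW // eq_ik.
  by move=> j jk nejk; rewrite eqi ?eqk // eq_ik.
have [ik | ki] := orP (r_total i k).
  exists i; rewrite -eqk //; split=> // j ji neji; rewrite eqi // eqk //.
    exact: r_trans ik.
  by apply: contra neq_ik => /eqP ejk; rewrite ejk in ji; apply/eqP/r_anti; rewrite ik.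
exists k; rewrite eqi //; last by rewrite eq_sym.
split=> // j jk nejk; rewrite eqi ?eqk //; first exact: r_trans ki.
by apply: contra neq_ik => /eqP eji; rewrite eji in jk; apply/eqP/r_anti; rewrite jk.
Qed.

Lemma ltw_trans v w s : ltw v w -> ltw w s -> ltw v s.
Proof.
case=> [vw | [vw cvw]] [ws | [ws cws]]; rewrite /ltw.
- by left; apply: ltn_trans ws.
- by left; rewrite -ws.
- by left; rewrite vw.
- by right; rewrite vw; split=> //; apply: ltc_trans cws.
Qed.

Lemma ltw_perm v v' w w' : perm_eq v v' -> perm_eq w w' -> ltw v w -> ltw v' w'.
Proof.
move=> pv pw; rewrite /ltw -(perm_size pv) -(perm_size pw).
case=> [vw | [vw [i [wi eqi]]]]; [by left | right; split=> //].
exists i; rewrite -(permP pv) -(permP pw); split=> // j ji neji.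
by rewrite -(permP pv) -(permP pw) eqi.
Qed.

Lemma ltw_irr v w : perm_eq v w -> ~ ltw v w.
Proof.
move=> pv; rewrite /ltw (perm_size pv) ltnn => -[//|[_ [i []]]].
by rewrite (permP pv) ltnn.
Qed.

Lemma ltw_catr v w s : ltw v w -> ltw (v ++ s) (w ++ s).
Proof.
rewrite /ltw !size_cat ltn_add2r => -[vw | [-> [i [wi eqi]]]]; first by left.
right; split=> //; exists i; rewrite !count_cat ltn_add2r; split=> // j ji neji.
by rewrite !count_cat eqi.
Qed.

Lemma ltw_cat v w v' w' : ltw v w -> lew v' w' -> ltw (v ++ v') (w ++ w').
Proof.
move=> vw [p' | vw'].
  by apply: (ltw_perm _ _ (ltw_catr v' vw)) => //; rewrite perm_cat2l.
apply: ltw_trans (ltw_catr v' vw) _.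
by apply: (ltw_perm _ _ (ltw_catr w vw')); rewrite perm_catC.
Qed.

Lemma lew_cat v w v' w' : lew v w -> ltw v' w' -> ltw (v ++ v') (w ++ w').
Proof.
move=> vw vw'; apply: (ltw_perm _ _ (ltw_cat vw' vw)); by rewrite perm_catC.
Qed.

Lemma ltw_total v w : [\/ perm_eq v w, ltw v w | ltw w v].
Proof.
rewrite /ltw; case: (ltngtP (size v) (size w)) => [vw | wv | eqs].
- by constructor 2; left.
- by constructor 3; left.
have [p | np] := boolP (perm_eq v w); first by constructor 1.
pose D := [seq i <- v ++ w | count_mem i v != count_mem i w].
have Dmem i : count_mem i v != count_mem i w -> i \in D.
  move=> ci; rewrite mem_filter ci mem_cat -!has_pred1 !has_count.
  by move: ci; case: (count_mem i v) => [|//]; case: (count_mem i w).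
have [m [Dm mP]] : exists m, m \in D /\ forall j, j \in D -> r m j.
  have Dn : D != [::].
    apply: contra np => /eqP D0; rewrite /perm_eq; apply/allP => i iv /=.
    by apply/negPn/negP => /Dmem; rewrite D0.
  have := sort_sorted r_total D; case def_s: (sort r D) => [|m s].
    by move: Dn; rewrite -size_eq0 -(size_sort r) def_s.
  rewrite /= (path_sortedE r_trans) => /andP[/allP ms _].
  exists m; split=> [|j]; rewrite -(mem_sort r) def_s ?mem_head //.
  by rewrite inE => /orP[/eqP->|/ms //]; have := r_total m m; rewrite orbb.
have below j : r j m -> j != m -> count_mem j v = count_mem j w.
  move=> jm nejm; apply/eqP; apply: contraNT nejm => /Dmem/mP mj.
  by apply/eqP/r_anti; rewrite jm.
move: Dm; rewrite mem_filter neq_ltn => /andP[/orP[vw | wv] _].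
  constructor 3; right; split=> //; exists m; split=> // j jm nejm.
  by rewrite below.
by constructor 2; right; split=> //; exists m.
Qed.

Lemma ltw_max (s : seq (seq I)) : s != [::] ->
  exists2 m, m \in s & forall v, v \in s -> lew v m.
Proof.
elim: s => // v [|w s] IHs _.
  by exists v; rewrite ?mem_head // => w; rewrite inE => /eqP->; left.
have [//|m ms mP] := IHs; have [vm | vm | mv] := ltw_total v m.
- exists m; first by rewrite inE ms orbT.
  by move=> x; rewrite inE => /orP[/eqP->|/mP //]; left.
- exists m; first by rewrite inE ms orbT.
  by move=> x; rewrite inE => /orP[/eqP->|/mP //]; right.
exists v; first exact: mem_head.
move=> x; rewrite inE => /orP[/eqP->|/mP [xm|xm]]; first by left.
  by right; apply: ltw_perm mv; rewrite // perm_sym.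
by right; apply: ltw_trans mv.
Qed.

End MonomialOrder.

(** * Leading monomials *)

Section Leading.
Variables (K : fieldType) (G : groupType).
Variables (eps : G -> G -> K) (eps_bichar : alternating_bicharacter eps).
Variables (L : lmodType K) (L_ : G -> L -> Prop) (br : L -> L -> L).
Hypothesis L_color : lie_color_algebra eps L_ br.
Variables (I : choiceType) (le : rel I) (e : I -> L) (d : I -> G).
Variable cd : L -> {malg K[I]}.
Hypothesis L_basis : color_basis eps L_ br le e d cd.
Variables (U : algType K) (iota : {linear L -> U}).
Hypothesis U_env : is_enveloping eps L_ br iota.

Local Notation W := (monomial le).
Local Notation P := {malg K[W]}.
Local Notation sort_word := (sort_word L_basis).
Local Notation y_ i := (iota (e i)).
Local Notation mon w := (\prod_(i <- w) y_ i).
Local Notation coef := (coef eps_bichar L_color L_basis U_env).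

Definition degU (u : U) : nat := \max_(w <- msupp (coef u)) size (val w).

Lemma degU_le n u : (degU u <= n)%N <-> size_le n (coef u).
Proof.
rewrite /degU; split=> [un w wu | lu].
  by apply: leq_trans un; rewrite (big_rem w wu) leq_maxl.
by apply/bigmax_leqP_seq => w /lu.
Qed.

Lemma degU0 : degU 0 = 0%N.
Proof. by rewrite /degU linear0 msupp0 big_nil. Qed.

Lemma degU_lin n a u v : (degU u <= n)%N -> (degU v <= n)%N -> (degU (a *: u + v) <= n)%N.
Proof.
move=> /degU_le lu /degU_le lv; apply/degU_le; rewrite coef_linear; exact: size_le_lin.
Qed.
Lemma degUZ n a u : (degU u <= n)%N -> (degU (a *: u) <= n)%N.
Proof. by move=> un; rewrite -[_ *: _]addr0 degU_lin // degU0. Qed.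
Lemma degUD n u v : (degU u <= n)%N -> (degU v <= n)%N -> (degU (u + v) <= n)%N.
Proof. by rewrite -{2}(scale1r u); apply: degU_lin. Qed.
Lemma degUB n u v : (degU u <= n)%N -> (degU v <= n)%N -> (degU (u - v) <= n)%N.
Proof. by move=> un vn; rewrite addrC -scaleN1r degU_lin. Qed.

Lemma degU_mon s : (degU (mon s) <= size s)%N.
Proof.
have [a [r [_ lr cs]]] := coef_mon eps_bichar L_color L_basis U_env s.
apply/degU_le; rewrite cs; apply: size_le_lin; first by apply: size_leU; rewrite size_sort_word.
by move=> v /lr/ltnW.
Qed.

Lemma degU_iotaM x n u : (degU u <= n)%N -> (degU (iota x * u) <= n.+1)%N.
Proof.
by move=> /degU_le lu; apply/degU_le; rewrite coef_iotaM; apply: lie_act_size_le.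
Qed.

Lemma degUM u v : (degU (u * v) <= degU u + degU v)%N.
Proof.
apply: (mon_ind (eps_bichar := eps_bichar) (L_color := L_color)
    (L_basis := L_basis) (U_env := U_env) (u := u) (S := fun u' => (degU (u' * v) <= degU u + degU v)%N)).
- by rewrite mul0r degU0.
- by move=> a u1 u2 ? ?; rewrite mulrDl -scalerAl degU_lin.
move=> w /((degU_le _ _).1 (leqnn _)) wu.
apply: leq_trans (_ : size (val w) + degU v <= _)%N; last by rewrite leq_add2r.
elim: (val w) => [|i s IHs]; first by rewrite big_nil mul1r.
by rewrite big_cons -mulrA; apply: degU_iotaM.
Qed.

Section Order.
Variable r : rel I.
Hypotheses (r_total : total r) (r_trans : transitive r) (r_anti : antisymmetric r).
Local Notation ltw := (ltw r).
Local Notation lew := (lew r).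

Definition below (w : seq I) (u : U) : Prop :=
  forall v, v \in msupp (coef u) -> ltw (val v) w.
Definition upto (w : seq I) (u : U) : Prop :=
  forall v, v \in msupp (coef u) -> lew (val v) w.

Lemma msupp_lin (a : K) (p p' : P) v : v \in msupp (a *: p + p') ->
  v \in msupp p \/ v \in msupp p'.
Proof.
rewrite -!mcoeff_neq0 mcoeffD mcoeffZ => ne; apply/orP.
by apply: contraNT ne; rewrite negb_or !negbK => /andP[/eqP-> /eqP->]; rewrite mulr0 addr0.
Qed.

Lemma below_lin w a u v : below w u -> below w v -> below w (a *: u + v).
Proof.
by move=> bu bv x; rewrite coef_linear => /msupp_lin[/bu|/bv].
Qed.
Lemma below0 w : below w 0.
Proof. by move=> v; rewrite linear0 msupp0. Qed.

Lemma below_mon v w : ltw v w -> below w (mon v).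
Proof.
have [a [p [_ lp cv]]] := coef_mon eps_bichar L_color L_basis U_env v.
move=> vw x; rewrite cv => /msupp_lin [|/lp xv].
  rewrite msupp_basis in_fset1 => /eqP->; apply: ltw_perm vw => //.
  by rewrite perm_sym perm_sort_word.
by apply: ltw_trans vw => //; left.
Qed.

Lemma upto_mon w : upto w (mon w).
Proof.
have [a [p [_ lp cw]]] := coef_mon eps_bichar L_color L_basis U_env w.
move=> x; rewrite cw => /msupp_lin [|/lp xv]; last by right; left.
by rewrite msupp_basis in_fset1 => /eqP->; left; rewrite perm_sort_word.
Qed.

Lemma belowM_of w w' u v :
  (forall x y, x \in msupp (coef u) -> y \in msupp (coef v) ->
     ltw (val x ++ val y) (w ++ w')) -> below (w ++ w') (u * v).
Proof.
move=> uv; apply: (mon_ind (eps_bichar := eps_bichar) (L_color := L_color)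
    (L_basis := L_basis) (U_env := U_env) (u := u) (S := fun u => below (w ++ w') (u * v))).
- by rewrite mul0r; apply: below0.
- by move=> a u1 u2 ? ?; rewrite mulrDl -scalerAl; apply: below_lin.
move=> x xu; apply: (mon_ind (eps_bichar := eps_bichar) (L_color := L_color)
    (L_basis := L_basis) (U_env := U_env) (u := v) (S := fun v => below (w ++ w') (mon (val x) * v))).
- by rewrite mulr0; apply: below0.
- by move=> a u1 u2 ? ?; rewrite mulrDr -scalerAr; apply: below_lin.
by move=> y yv; rewrite -big_cat; apply/below_mon/uv.
Qed.

Lemma belowM w w' u v : below w u -> upto w' v -> below (w ++ w') (u * v).
Proof. by move=> bu uv; apply: belowM_of => x y /bu xu /uv; apply: ltw_cat. Qed.
Lemma uptoM w w' u v : upto w u -> below w' v -> below (w ++ w') (u * v).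
Proof. by move=> uu bv; apply: belowM_of => x y /uu xu /bv; apply: lew_cat. Qed.

(** Up to a scalar and smaller monomials, u is the product of the word w. *)
Definition lead (u : U) (w : seq I) : Prop :=
  exists a u', [/\ a != 0, below w u' & u = a *: mon w + u'].

(** The product of the two words is literally a monomial of the product, and all
    the other products are below it. *)
Lemma leadM u v w w' : lead u w -> lead v w' -> lead (u * v) (w ++ w').
Proof.
move=> [a [u' [a0 bu ->]]] [b [v' [b0 bv ->]]].
exists (a * b), (a *: (mon w * v') + (u' * (b *: mon w' + v'))).
split; first by rewrite mulf_neq0.
  apply: below_lin; first by apply: uptoM => //; apply: upto_mon.
  apply: belowM => // x; rewrite coef_linear => /msupp_lin[/upto_mon //|/bv]; by right.
rewrite big_cat /= mulrDl mulrDr addrA -!scalerAl -scalerAr scalerA; congr (_ + _).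
Qed.

(** This is where the linear independence of monomials enters: no monomial below
    w contributes to the coefficient at w. *)
Lemma lead_coef u w : lead u w -> (coef u)@_(sort_word w) != 0.
Proof.
move=> [a [u' [a0 bu ->]]]; rewrite coef_linear mcoeffD mcoeffZ.
have [b [p [b0 lp ->]]] := coef_mon eps_bichar L_color L_basis U_env w.
rewrite mcoeffD mcoeffZ mcoeff_basis eqxx mulr1.
have -> : p@_(sort_word w) = 0.
  by apply/eqP; rewrite mcoeff_eq0; apply/negP => /lp; rewrite size_sort_word ltnn.
have -> : (coef u')@_(sort_word w) = 0.
  apply/eqP; rewrite mcoeff_eq0; apply/negP => /bu; apply: ltw_irr.
  exact: perm_sort_word.
by rewrite !addr0 mulf_neq0.
Qed.

Lemma lead_upto u w : lead u w -> upto w u.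
Proof.
move=> [a [u' [a0 bu ->]]] x; rewrite coef_linear => /msupp_lin[/upto_mon //|/bu]; by right.
Qed.

Lemma lead_neq0 u w : lead u w -> u != 0.
Proof.
by move=> /lead_coef; apply: contraNneq => ->; rewrite linear0 mcoeff0.
Qed.

Lemma lead_exists u : u != 0 -> exists w, lead u w.
Proof.
move=> u0; have su : [seq val v | v <- msupp (coef u)] != [::].
  apply: contraNneq u0 => /(congr1 size); rewrite size_map /= => /size0nil su.
  by rewrite (mon_span eps_bichar L_color L_basis U_env u) unlock su big_nil.
have [w /mapP[v vu ->] vP] := ltw_max r_total r_trans r_anti su.
have cv : (coef u)@_v != 0 by rewrite mcoeff_neq0.
exists (val v), (coef u)@_v, (u - (coef u)@_v *: mon (val v)); split=> //.
  move=> x; rewrite linearB linearZ /= coef_mon_sorted.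
  rewrite -mcoeff_neq0 mcoeffB mcoeffZ mcoeff_basis.
  have [->|nexv] := eqVneq v x; first by rewrite mulr1 subrr eqxx.
  rewrite mulr0 subr0 mcoeff_neq0 => xu.
  have [] // := vP (val x) (map_f _ xu).
  move=> /(sort_word_perm L_basis); rewrite !sort_wordK => exv; by rewrite exv eqxx in nexv.
by rewrite addrC subrK.
Qed.

Lemma lead_uniq u w w' : lead u w -> lead u w' -> perm_eq w w'.
Proof.
move=> lw lw'; have := lead_coef lw; have := lead_coef lw'.
rewrite !mcoeff_neq0 => /(lead_upto lw) ww' /(lead_upto lw') w'w.
have pw := perm_sort_word L_basis w; have pw' := perm_sort_word L_basis w'.
case: ww' => [p|ww']; first by rewrite perm_sym -(permPl pw').
case: w'w => [p|w'w]; first by rewrite -(permPl pw).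
case: (ltw_irr (perm_refl w) (r := r)).
exact: (ltw_trans r_total r_trans r_anti (ltw_perm pw (perm_refl _) w'w)
                  (ltw_perm pw' (perm_refl _) ww')).
Qed.

Lemma lead_deg u w : lead u w -> degU u = size w.
Proof.
move=> lw; apply/eqP; rewrite eqn_leq; apply/andP; split.
  apply/degU_le => v /(lead_upto lw) [/perm_size-> // | [/ltnW // | [-> //]]].
have /degU_le/(_ (sort_word w)) := leqnn (degU u).
by rewrite size_sort_word; apply; rewrite -mcoeff_neq0; apply: lead_coef.
Qed.

Lemma lead_lower u v w : lead u w -> (degU v < size w)%N -> lead (u + v) w.
Proof.
move=> [a [u' [a0 bu ->]]] vw; exists a, (u' + v); split; rewrite ?addrA //.
rewrite -[u']scale1r; apply: below_lin => // x xv; left; apply: leq_ltn_trans vw.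
exact: ((degU_le _ _).1 (leqnn _)).
Qed.

Lemma leadZ a u w : a != 0 -> lead u w -> lead (a *: u) w.
Proof.
move=> a0 [b [u' [b0 bu ->]]]; exists (a * b), (a *: u'); split.
- by rewrite mulf_neq0.
- by rewrite -[_ *: _]addr0; apply: below_lin => //; apply: below0.
by rewrite scalerDr scalerA.
Qed.

Lemma lead_gen i : lead (y_ i) [:: i].
Proof.
by exists 1, 0; split; rewrite ?oner_eq0 //; [apply: below0 | rewrite scale1r addr0 big_seq1].
Qed.

End Order.

(** The product of the leading monomials is a leading monomial. *)
Lemma enveloping_domain (u v : U) : u * v = 0 -> u = 0 \/ v = 0.
Proof.
move=> uv0; have [->|u0] := eqVneq u 0; first by left.
have [->|v0] := eqVneq v 0; first by right.
have [w lu] := lead_exists (cb_total L_basis) (cb_trans L_basis) (cb_anti L_basis) u0.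
have [w' lv] := lead_exists (cb_total L_basis) (cb_trans L_basis) (cb_anti L_basis) v0.
have := lead_neq0 (leadM (cb_total L_basis) (cb_trans L_basis) (cb_anti L_basis) lu lv).
by rewrite uv0 eqxx.
Qed.

Lemma degU_mul (u v : U) : u != 0 -> v != 0 -> degU (u * v) = (degU u + degU v)%N.
Proof.
move=> u0 v0.
have [w lu] := lead_exists (cb_total L_basis) (cb_trans L_basis) (cb_anti L_basis) u0.
have [w' lv] := lead_exists (cb_total L_basis) (cb_trans L_basis) (cb_anti L_basis) v0.
have luv := leadM (cb_total L_basis) (cb_trans L_basis) (cb_anti L_basis) lu lv.
by rewrite (lead_deg lu) (lead_deg lv) (lead_deg luv) size_cat.
Qed.

End Leading.

(** * Homogeneous bases *)

Section WellOrder.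
Variables (T : eqType) (R : rel T).
Hypothesis R_wo : well_order R.

Lemma wo_min (A : T -> Prop) : (exists x, A x) ->
  exists2 m, A m & forall x, A x -> R m x.
Proof.
move=> [x Ax]; have [|m [[mA mP] _]] := R_wo (A := fun x => `[< A x >]).
  by exists x; apply/asboolP.
by exists m => [|y Ay]; [apply/asboolP | apply: mP; apply/asboolP].
Qed.

Lemma wo_total : total R.
Proof.
move=> x y; have [|m [->|->] mP] := @wo_min (fun z => z = x \/ z = y).
- by exists x; left.
- by rewrite mP //; right.
by rewrite (mP x) ?orbT //; left.
Qed.

Lemma wo_anti : antisymmetric R.
Proof.
move=> x y /andP[xy yx].
have xx : R x x by have := wo_total x x; rewrite orbb.
have yy : R y y by have := wo_total y y; rewrite orbb.
have [|m [_ basis_vector]] := R_wo (A := [pred z | (z == x) || (z == y)]).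
  by exists x; rewrite inE eqxx.
rewrite -(basis_vector x) ?(basis_vector y) //; split; rewrite ?inE ?eqxx ?orbT // => z.
  by rewrite inE => /orP[/eqP->|/eqP->].
by rewrite inE => /orP[/eqP->|/eqP->].
Qed.

Lemma wo_trans : transitive R.
Proof.
move=> y x z xy yz.
have [|m [->|[]->] mP] := @wo_min (fun t => t = x \/ (t = y \/ t = z)).
- by exists x; left.
- by apply: mP; right; right.
- have yx : R y x by apply: mP; left.
  by rewrite (wo_anti (x := x) (y := y)) // xy.
have zy : R z y by apply: mP; right; left.
by rewrite -(wo_anti (x := y) (y := z)) // yz.
Qed.

Lemma wo_ind (P : T -> Prop) :
  (forall x, (forall y, R y x -> y != x -> P y) -> P x) -> forall x, P x.
Proof.
move=> IH x; apply: contrapT => nPx.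
have [|m nPm mP] := @wo_min (fun x => ~ P x); first by exists x.
apply: nPm; apply: IH => y ym neq_ym; apply: contrapT => /mP my.
by move: neq_ym; rewrite (wo_anti (x := y) (y := m)) ?eqxx // ym.
Qed.

Lemma wo_max (s : seq T) : s != [::] -> exists2 m, m \in s & forall x, x \in s -> R x m.
Proof.
elim: s => // x [|y s] IHs _.
  exists x; rewrite ?mem_head // => z; rewrite inE => /eqP->.
  by have := wo_total x x; rewrite orbb.
have [//|m ms mP] := IHs; have [xm | mx] := orP (wo_total x m).
  by exists m => [|z]; rewrite inE ?ms ?orbT // => /orP[/eqP->|/mP].
exists x => [|z]; rewrite inE ?eqxx // => /orP[/eqP->|/mP zm].
  by have := wo_total x x; rewrite orbb.
exact: wo_trans mx.
Qed.

End WellOrder.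

Lemma sum_pred1_uniq (V : nmodType) (T : eqType) (s : seq T) i (F : T -> V) :
  uniq s -> i \in s -> \sum_(h <- s | h == i) F h = F i.
Proof. by move=> Us si; rewrite -big_filter filter_pred1_uniq // big_seq1. Qed.

Section HomogeneousBasis.
Variables (K : fieldType) (G : groupType).
Variables (eps : G -> G -> K) (eps_bichar : alternating_bicharacter eps).
Variables (L : lmodType K) (L_ : G -> L -> Prop) (br : L -> L -> L).
Hypothesis L_color : lie_color_algebra eps L_ br.
Hypothesis L_even : even_color eps L_ br.

Let L_grading := color_grading L_color.

Inductive lspan (A : L -> Prop) : L -> Prop :=
| lspan0 : lspan A 0
| lspan_lin (a : K) x y : A x -> lspan A y -> lspan A (a *: x + y).

Lemma lspan_add A x y : lspan A x -> lspan A y -> lspan A (x + y).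
Proof.
move=> sx sy; elim: sx => [|a u v Au _ IH]; first by rewrite add0r.
by rewrite -addrA; apply: lspan_lin.
Qed.
Lemma lspan_scale A (a : K) x : lspan A x -> lspan A (a *: x).
Proof.
elim=> [|b u v Au _ IH]; first by rewrite scaler0; apply: lspan0.
by rewrite scalerDr scalerA; apply: lspan_lin.
Qed.

Let homogeneous (x : L) : Prop := exists g, L_ g x.

Variables (R : rel L) (R_wo : well_order R).

(** A homogeneous vector belongs to the basis when the homogeneous vectors
    that precede it in a well-order of L do not span it. *)
Definition basic (x : L) : Prop :=
  homogeneous x /\ ~ lspan (fun y => [/\ homogeneous y, R y x & y != x]) x.

Definition basis_index : choiceType := Choice.clone {x : L | `[< basic x >]} _.
Local Notation I := basis_index.
Let e (i : I) : L := val i.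

Lemma basis_hom i : homogeneous (e i).
Proof. by have /asboolP[] := valP i. Qed.

Let d (i : I) : G := sval (cid (basis_hom i)).
Let d_hom i : L_ (d i) (e i) := svalP (cid (basis_hom i)).

(** The largest basis element in a linear relation would be spanned by smaller
    ones. *)
Lemma basis_free (p : {malg K[I]}) : lin_ext e p = 0 -> p = 0.
Proof.
move=> p0; apply/malgP => i; rewrite mcoeff0; apply/eqP; apply: contraT => pi0.
have ip : i \in msupp p by rewrite -mcoeff_neq0.
have [|m /mapP[j jp ->] mP] := wo_max R_wo (s := [seq e k | k <- msupp p]).
  apply/eqP => /(congr1 size); rewrite size_map /= => /size0nil s0.
  by rewrite -[i \in _]/(i \in (msupp p : seq _)) s0 in ip.
have pj0 : p@_j != 0 by rewrite mcoeff_neq0.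
have [_] : basic (e j) by apply/asboolP; apply: (valP j).
case; move: p0; rewrite unlock (bigD1_seq j) //= => /eqP; rewrite addr_eq0.
move=> /eqP/(congr1 ( *:%R (p@_j)^-1)); rewrite scalerA mulVf // scale1r => ej.
rewrite [X in lspan _ X]ej -scaleN1r; do 2!apply: lspan_scale.
rewrite big_seq_cond; elim/big_ind: _ => [|x y|k /andP[kp nekj]].
- exact: lspan0.
- exact: lspan_add.
rewrite -[_ *: _]addr0; apply: lspan_lin; last exact: lspan0.
split; [exact: basis_hom | exact/mP/map_f |].
by apply: contra nekj => /eqP/val_inj->.
Qed.

(** Well-founded induction: a homogeneous vector is basic, or it is spanned by
    smaller homogeneous vectors. *)
Lemma basis_spans x : exists p : {malg K[I]}, x = lin_ext e p.
Proof.
have spanD (y z : L) : (exists p : {malg K[I]}, y = lin_ext e p) ->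
    (exists p : {malg K[I]}, z = lin_ext e p) -> exists p : {malg K[I]}, y + z = lin_ext e p.
  by move=> [p ->] [p' ->]; exists (p + p'); rewrite raddfD.
have span0 : exists p : {malg K[I]}, 0 = lin_ext e p by exists 0; rewrite raddf0.
have [s [c [c_hom ->]]] := grading_span L_grading x.
elim/big_ind: _ => // g _; have : homogeneous (c g) by exists g.
elim/(wo_ind R_wo): (c g) => y IH y_hom.
have [yB | nyB] := pselect (basic y).
  by exists << (exist _ y (asboolT yB) : I) >>; rewrite lin_extU.
have : lspan (fun z => [/\ homogeneous z, R z y & z != y]) y.
  by apply: contrapT => ny; apply: nyB.
elim=> // a z t [hz zy nzy] _ IHt; apply: spanD => //.
by have [p ->] := IH z zy nzy hz; exists (a *: p); rewrite linearZ.
Qed.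

Let cd x : {malg K[I]} := sval (cid (basis_spans x)).
Let cdP x : x = lin_ext e (cd x) := svalP (cid (basis_spans x)).

Lemma basis_coord_uniq p : cd (lin_ext e p) = p.
Proof.
apply/eqP; rewrite -subr_eq0; apply/eqP/basis_free.
by rewrite raddfB /= -cdP subrr.
Qed.

(** The part of the expansion of x that lies in a degree other than g vanishes,
    because degrees are independent; then so do its coefficients. *)
Lemma basis_coord_deg g x i : L_ g x -> i \in msupp (cd x) -> d i = g.
Proof.
move=> gx ix; apply: contrapT => neq_dg; set p := cd x in ix.
have sum_hom h (T : seq I) (Q : pred I) :
    (forall k, Q k -> d k = h) -> L_ h (\sum_(k <- T | Q k) p@_k *: e k).
  move=> Qh; elim/big_ind: _ => [|y z hy hz|k /Qh <-].
  - exact: (grading0 L_grading).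
  - by rewrite -[y]scale1r; apply: (gradingP L_grading).
  - by rewrite -[_ *: _]addr0; apply: (gradingP L_grading) => //; apply: (grading0 L_grading).
pose c h := \sum_(k <- msupp p | d k == h) p@_k *: e k - (if h == g then x else 0).
pose s := undup (g :: [seq d k | k <- msupp p]).
have c_hom h : L_ h (c h).
  rewrite /c addrC -scaleN1r; apply: (gradingP L_grading).
    by case: eqP => [->|_] //; apply: (grading0 L_grading).
  by apply: sum_hom => k /eqP.
have sum_c : \sum_(h <- s) c h = 0.
  rewrite sumrB -big_mkcond (sum_pred1_uniq _ (undup_uniq _)) ?mem_undup ?mem_head //=.
  rewrite (exchange_big_dep xpredT) //= [X in _ - X](cdP x) lin_ext.unlock.
  apply/eqP; rewrite subr_eq0; apply/eqP; apply: eq_big_seq => k kp /=.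
  under eq_bigl do rewrite eq_sym.
  by rewrite (sum_pred1_uniq _ (undup_uniq _)) // mem_undup inE map_f ?orbT.
have := grading_indep L_grading (undup_uniq _) c_hom sum_c.
move=> /(_ (d i)); rewrite mem_undup inE map_f ?orbT // => /(_ isT).
rewrite /c (introF eqP neq_dg) subr0 => sum0.
pose p' : {malg K[I]} := \sum_(k <- msupp p | d k == d i) p@_k *: << k >>.
have /basis_free : lin_ext e p' = 0.
  by rewrite raddf_sum /= -[RHS]sum0; apply: eq_bigr => k _; rewrite linearZ /= lin_extU.
move=> /(congr1 (mcoeff i)); rewrite mcoeff0 raddf_sum /= -big_filter.
rewrite (bigD1_seq i) ?mem_filter ?eqxx //= ?filter_uniq //.
rewrite mcoeffZ mcoeff_basis eqxx mulr1 big1 ?addr0 => [/eqP|k neq_ki].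
  by rewrite mcoeff_eq0 ix.
by rewrite mcoeffZ mcoeff_basis (negPf neq_ki) mulr0.
Qed.

Lemma color_basis_of_wo :
  color_basis eps L_ br (fun i j : I => R (e i) (e j)) e d cd.
Proof.
have e_neq0 i : e i != 0.
  apply/eqP => ei0; have [_] : basic (e i) by apply/asboolP; apply: (valP i).
  by rewrite ei0; case; apply: lspan0.
have eps1 i : eps (d i) (d i) = 1.
  apply/eqP; apply: contraT => /(even_odd_part L_even) /(_ (e i) (d_hom i)) ei0.
  by have := e_neq0 i; rewrite ei0 eqxx.
split=> //.
- by move=> i j; apply: wo_total.
- by move=> j i k; apply: wo_trans.
- by move=> i j /(wo_anti R_wo)/val_inj.
- move=> a x y; apply/eqP; rewrite -subr_eq0; apply/eqP/basis_free.
  by rewrite raddfB /= lin_ext_linear -!cdP subrr.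
- by move=> i; rewrite -[LHS](basis_coord_uniq _) -cdP -[e i]lin_extU basis_coord_uniq.
- exact: basis_coord_deg.
move=> i; have [ch2 | nch2] := boolP (2%N \in [pchar K]).
  exact: (even_char2 L_even) (d_hom i).
have := color_anti L_color (d_hom i) (d_hom i); rewrite eps1 scale1r => /eqP.
rewrite -subr_eq0 opprK -mulr2n -scaler_nat scaler_eq0 => /orP[|/eqP//].
by move: nch2; rewrite !inE /= => /negPf->.
Qed.

End HomogeneousBasis.

Lemma color_basis_exists (K : fieldType) (G : groupType) (eps : G -> G -> K)
    (L : lmodType K) (L_ : G -> L -> Prop) (br : L -> L -> L) :
  lie_color_algebra eps L_ br -> even_color eps L_ br ->
  exists (I : choiceType) (le : rel I) (e : I -> L) (d : I -> G)
    (cd : L -> {malg K[I]}), color_basis eps L_ br le e d cd.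
Proof.
move=> L_color L_even; have [R R_wo] := well_ordering_principle L.
by do 5!eexists; apply: (color_basis_of_wo L_color L_even R_wo).
Qed.

(** * The grading of the enveloping algebra *)

Section Grading.
Variables (K : fieldType) (G : groupType) (G_abelian : abelian_group G).
Variables (eps : G -> G -> K) (eps_bichar : alternating_bicharacter eps).
Variables (L : lmodType K) (L_ : G -> L -> Prop) (br : L -> L -> L).
Hypothesis L_color : lie_color_algebra eps L_ br.
Hypothesis L_proper : proper_grading eps L_.
Variables (I : choiceType) (le : rel I) (e : I -> L) (d : I -> G).
Variable cd : L -> {malg K[I]}.
Hypothesis L_basis : color_basis eps L_ br le e d cd.
Variables (U : algType K) (iota : {linear L -> U}).
Hypothesis U_env : is_enveloping eps L_ br iota.

Local Notation W := (monomial le).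
Local Notation P := {malg K[W]}.
Local Notation sort_word := (sort_word L_basis).
Local Notation y_ i := (iota (e i)).
Local Notation mon w := (\prod_(i <- w) y_ i).
Local Notation coef := (coef eps_bichar L_color L_basis U_env).
Local Notation degU := (degU eps_bichar L_color L_basis U_env).
Local Notation env_grade := (env_grade L_ iota).

(** This is what properness of the grading provides: the support of L generates
    G, and no element of G pairs trivially with all of G. *)
Lemma degree_separated g g' : (forall i, eps (d i) g = eps (d i) g') -> g = g'.
Proof.
move=> eq_gg'; suff /(proper_radical L_proper) : forall k, eps (g * g'^-1)%g k = 1.
  exact: divg1_eq.
move=> k; rewrite (bicharV eps_bichar) (bicharM eps_bichar) (bicharVr eps_bichar).
suff -> : eps k g / eps k g' = 1 by rewrite invr1.
elim: (proper_generated L_proper k) => [h [x hx x0]||h h' _ IH _ IH'|h _ IH].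
- have [i ix] : exists i, i \in msupp (cd x).
    apply: contrapT => nx; case/eqP: x0; rewrite (cb_span L_basis x) lin_ext.unlock.
    by rewrite big_seq big1 // => i ix; case: nx; exists i.
  rewrite -(cb_coord_deg L_basis hx ix) eq_gg' mulfV //.
  exact: (bichar_neq0 eps_bichar).
- by rewrite !(bichar1l eps_bichar) divr1.
- by rewrite !(bicharMl eps_bichar) invfM mulrACA IH IH' mulr1.
by rewrite !(bicharVl eps_bichar) -invfM IH invr1.
Qed.

(** ** The automorphisms attached to the grading *)

Definition twist k x : L := lin_ext (fun i => eps k (d i) *: e i) (cd x).

Lemma twist_hom k g x : L_ g x -> twist k x = eps k g *: x.
Proof.
move=> gx; rewrite [in RHS](cb_span L_basis x).
rewrite (lin_ext_comp (F := *:%R (eps k g))) => [|a u v]; last first.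
  by rewrite scalerDr !scalerA mulrC.
by apply: eq_lin_ext => i /(cb_coord_deg L_basis gx) /= ->.
Qed.

Definition iota_twist k x : U := iota (twist k x).
Fact iota_twist_linear k : linear (iota_twist k).
Proof.
move=> a x x'; rewrite /iota_twist -linearP; congr (iota _).
by rewrite /twist (cb_linear L_basis) lin_ext_linear.
Qed.
HB.instance Definition _ k :=
  GRing.isLinear.Build K L U *:%R (iota_twist k) (iota_twist_linear k).

Fact phi_exists k : exists F : {lrmorphism U -> U},
  forall x, F (iota x) = iota (twist k x).
Proof.
have rel : color_relations eps L_ br (iota_twist k).
  move=> g h x y gx hy; rewrite /iota_twist (twist_hom k gx) (twist_hom k hy).
  rewrite (twist_hom k (color_degree L_color gx hy)) !linearZ /=.
  rewrite -(env_rel U_env gx hy) (bicharM eps_bichar) -!scalerAl -!scalerAr !scalerA.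
  rewrite scalerBr scalerN !scalerA; congr (_ *: _ - _ *: _); ring.
by have [F [Fi _]] := env_univ U_env (f := iota_twist k) rel; exists F.
Qed.

Definition phi k : {lrmorphism U -> U} := sval (cid (phi_exists k)).
Lemma phi_iota k g x : L_ g x -> phi k (iota x) = eps k g *: iota x.
Proof.
by move=> gx; rewrite (svalP (cid (phi_exists k))) (twist_hom k gx) linearZ.
Qed.
Lemma phi_gen k i : phi k (y_ i) = eps k (d i) *: y_ i.
Proof. exact: phi_iota (cb_hom L_basis i). Qed.

Lemma phi_grade k g u : env_grade g u -> phi k u = eps k g *: u.
Proof.
elim=> [|h h' x v hx _ IH|h|h a v w _ IHv _ IHw].
- by rewrite rmorph1 (bichar1r eps_bichar) scale1r.
- by rewrite rmorphM /= (phi_iota k hx) IH -scalerAl -scalerAr scalerA -(bicharM eps_bichar).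
- by rewrite raddf0 scaler0.
by rewrite linearP /= IHv IHw scalerDr !scalerA mulrC.
Qed.

Lemma phiVK k u : phi k (phi k^-1%g u) = u.
Proof.
move: u; apply: (enveloping_ind L_basis U_env) => [|a u v IHu IHv|i u IH].
- by rewrite !rmorph1.
- by rewrite !linearP /= IHu IHv.
rewrite !rmorphM /= IH phi_gen linearZ /= phi_gen scalerA; congr (_ * _).
by rewrite (bicharVl eps_bichar) mulVf ?scale1r // (bichar_neq0 eps_bichar).
Qed.

(** ** Homogeneous components *)

Definition wdeg (s : seq I) : G := foldr (fun i g => (d i * g)%g) 1%g s.

Lemma mon_grade s : env_grade (wdeg s) (mon s).
Proof.
elim: s => [|i s IHs]; first by rewrite big_nil; apply: env_grade1.
by rewrite big_cons; apply: env_gradeM => //; apply: (cb_hom L_basis).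
Qed.

Lemma coef_at_lin a u v w :
  (coef (a *: u + v))@_w = a * (coef u)@_w + (coef v)@_w.
Proof. by rewrite coef_linear mcoeffD mcoeffZ. Qed.

Lemma coef_phi k u w : (coef (phi k u))@_w = eps k (wdeg (val w)) * (coef u)@_w.
Proof.
apply: (mon_ind (eps_bichar := eps_bichar) (L_color := L_color)
  (L_basis := L_basis) (U_env := U_env) (u := u)
  (S := fun u => (coef (phi k u))@_w = eps k (wdeg (val w)) * (coef u)@_w)).
- by rewrite !raddf0 mulr0.
- move=> a v v' IH IH'.
  have -> : phi k (a *: v + v') = a *: phi k v + phi k v' by rewrite linearP.
  rewrite coef_at_lin [in RHS]coef_at_lin.
  by rewrite IH IH' mulrDr mulrCA.
move=> v _; rewrite (phi_grade k (mon_grade _)) linearZ /= coef_mon_sorted mcoeffZ.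
by rewrite mcoeff_basis; have [->|] := eqVneq v w; rewrite // !mulr0.
Qed.

Lemma grade_sum u : exists (s : seq G) (c : G -> U),
  [/\ uniq s, forall g, env_grade g (c g) & u = \sum_(g <- s) c g].
Proof.
pose M := msupp (coef u); pose f w := (coef u)@_w *: mon (val w).
exists (undup [seq wdeg (val w) | w <- M]).
exists (fun g => \sum_(w <- M | wdeg (val w) == g) f w); split.
- exact: undup_uniq.
- move=> g; elim/big_ind: _ => [|x y gx gy|w /eqP <-].
  + exact: env_grade0.
  + by rewrite -[x]scale1r; apply: env_gradeP.
  by rewrite -[f w]addr0; apply: env_gradeP; [apply: mon_grade | apply: env_grade0].
rewrite (exchange_big_dep xpredT) //=.
rewrite [LHS](mon_span eps_bichar L_color L_basis U_env) lin_ext.unlock.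
apply: eq_big_seq => w wM /=.
under [RHS]eq_bigl do rewrite eq_sym.
by rewrite (sum_pred1_uniq _ (undup_uniq _)) // mem_undup; exact: (map_f (fun w : W => wdeg (val w)) wM).
Qed.

(** Homogeneous components are eigenvectors of the phi k, for characters that
    are distinct by degree_separated. *)
Lemma grade_indep (s : seq G) (c : G -> U) : uniq s ->
  (forall g, env_grade g (c g)) -> \sum_(g <- s) c g = 0 ->
  forall g, g \in s -> c g = 0.
Proof.
elim: s c => [//|g0 s IHs] c /= /andP[g0s Us] c_hom sum0.
have cs0 g : g \in s -> c g = 0.
  move=> gs; apply: contrapT => cg0.
  have neq : g != g0 by apply: contraNneq g0s => <-.
  case/eqP: neq; apply: degree_separated => i; set k := d i.
  pose c' h := (eps k h - eps k g0) *: c h.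
  have c'_hom h : env_grade h (c' h).
    by rewrite /c' -[_ *: _]addr0; apply: env_gradeP; [|apply: env_grade0].
  have sum0' : \sum_(h <- s) c' h = 0.
    transitivity (\sum_(h <- g0 :: s) c' h).
      by rewrite big_cons {2}/c' subrr scale0r add0r.
    transitivity (phi k (\sum_(h <- g0 :: s) c h) - eps k g0 *: \sum_(h <- g0 :: s) c h).
      rewrite raddf_sum scaler_sumr -sumrB; apply: eq_bigr => h _.
      by rewrite /= (phi_grade k (c_hom h)) -scalerBl.
    by rewrite sum0 raddf0 scaler0 subrr.
  have /eqP := IHs c' Us c'_hom sum0' g gs; rewrite scaler_eq0 => /orP[|/eqP//].
  by rewrite subr_eq0 => /eqP.
move=> g; rewrite inE => /orP[/eqP->|/cs0 //].
by move: sum0; rewrite big_cons big_seq big1 ?addr0.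
Qed.

Lemma grade_mul g h u v : env_grade g u -> env_grade h v -> env_grade (g * h)%g (u * v).
Proof.
move=> gu hv; elim: gu => [|g' g'' x w gx _ IH|g'|g' a w w' _ IH _ IH'].
- by rewrite mul1g mul1r.
- by rewrite -mulgA -mulrA; apply: env_gradeM.
- by rewrite mul0r; apply: env_grade0.
by rewrite mulrDl -scalerAl; apply: env_gradeP.
Qed.

(** ** Color commutators *)

(** Moving x past a letter costs a factor eps and a bracket, which shortens the
    word. *)
Lemma degU_mon_comm i s :
  (degU (y_ i * mon s - eps (d i) (wdeg s) *: (mon s * y_ i)) <= size s)%N.
Proof.
elim: s => [|j s IHs].
  by rewrite big_nil mulr1 mul1r (bichar1r eps_bichar) scale1r subrr degU0.
have -> : y_ i * mon (j :: s) - eps (d i) (wdeg (j :: s)) *: (mon (j :: s) * y_ i) =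
   iota (br (e i) (e j)) * mon s + eps (d i) (d j) *:
     (y_ j * (y_ i * mon s - eps (d i) (wdeg s) *: (mon s * y_ i))).
  rewrite big_cons -(env_rel U_env (cb_hom L_basis i) (cb_hom L_basis j)).
  rewrite /= (bicharM eps_bichar) mulrBl mulrBr scalerBr -!scalerAl -!scalerAr scalerA.
  by rewrite !mulrA addrA subrK.
apply: degUD; first exact/degU_iotaM/degU_mon.
by apply/degUZ/degU_iotaM.
Qed.

Lemma degU_comm i u : (degU (y_ i * u - phi (d i) u * y_ i) <= degU u)%N.
Proof.
apply: (mon_ind (eps_bichar := eps_bichar) (L_color := L_color)
  (L_basis := L_basis) (U_env := U_env) (u := u)
  (S := fun v => (degU (y_ i * v - phi (d i) v * y_ i) <= degU u)%N)).
- by rewrite raddf0 mulr0 mul0r subrr degU0.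
- move=> a v v' IH IH'; rewrite linearP mulrDr mulrDl -scalerAr -scalerAl.
  by rewrite opprD addrACA -scalerBr degU_lin.
move=> w /((degU_le eps_bichar L_color L_basis U_env _ _).1 (leqnn _)).
apply: leq_trans; rewrite (phi_grade _ (mon_grade _)) -scalerAl.
exact: degU_mon_comm.
Qed.

Lemma degU_gen_mul i u : u != 0 -> degU (y_ i * u) = (degU u).+1.
Proof.
have lead_i := @lead_gen _ _ _ eps_bichar _ _ _ L_color _ _ _ _ _ L_basis _ _ U_env le i.
move=> u0; rewrite degU_mul ?(lead_deg lead_i) ?(lead_neq0 lead_i) //.
Qed.

(** ** Ideals contain homogeneous elements *)

(** The leading terms of a x b and b x a differ by the characters of the
    degrees of a and b, once a and b commute. *)
Lemma commuting_homogeneous g h a b : env_grade g a -> env_grade h b ->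
  a != 0 -> b != 0 -> a * b = b * a ->
  (forall i, a * y_ i * b = b * y_ i * a) -> g = h.
Proof.
move=> ga hb a0 b0 ab aib; apply: degree_separated => i.
apply: contrapT => /eqP; rewrite eq_sym -subr_eq0 => neq.
have da := degU_comm i a; rewrite (phi_grade _ ga) -scalerAl in da.
have db := degU_comm i b; rewrite (phi_grade _ hb) -scalerAl in db.
have : (degU (eps (d i) h *: ((y_ i * a - eps (d i) g *: (a * y_ i)) * b)
   - eps (d i) g *: ((y_ i * b - eps (d i) h *: (b * y_ i)) * a)) <= degU a + degU b)%N.
  apply: degUB; apply: degUZ; apply: leq_trans (degUM _ _ _ _ _ _) _.
    by rewrite leq_add2r.
  by rewrite addnC leq_add2l.
have -> : eps (d i) h *: ((y_ i * a - eps (d i) g *: (a * y_ i)) * b)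
   - eps (d i) g *: ((y_ i * b - eps (d i) h *: (b * y_ i)) * a) =
   (eps (d i) h - eps (d i) g) *: (y_ i * (a * b)).
  rewrite !mulrBl -!scalerAl aib !scalerBr !scalerA (mulrC (eps (d i) g)).
  by rewrite opprB addrA subrK -!mulrA -ab scalerBl.
have ab0 : a * b != 0.
  by apply/eqP => /(enveloping_domain eps_bichar L_color L_basis U_env)[/eqP|/eqP];
     rewrite ?(negPf a0) ?(negPf b0).
have -> : degU ((eps (d i) h - eps (d i) g) *: (y_ i * (a * b))) = (degU a + degU b).+1.
  rewrite -degU_mul // -(degU_gen_mul i ab0); apply/eqP; rewrite eqn_leq degUZ //=.
  by rewrite -[X in (degU X <= _)%N](scalerK neq) degUZ.
by rewrite ltnn.
Qed.

(** Take t in J with as few components as possible, and let c be one of them.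
    For homogeneous y, the element t y c - c y t of J has fewer components, so
    it is 0; thus the components of t commute with c, even with a generator in
    between, and all of them have the degree of c. *)
Lemma ideal_homogeneous (J : U -> Prop) : nonzero_ideal J ->
  exists a g, [/\ J a, a != 0 & env_grade g a].
Proof.
move=> JI; have [t Jt t0] := ideal_neq0 JI.
have [s [c [Us c_hom def_t]]] := grade_sum t; rewrite {}def_t in Jt t0.
have [n] := ubnP (size s); elim: n s c Us c_hom Jt t0 => // n IHn.
case=> [|g0 s] c; first by rewrite big_nil eqxx.
move=> /= /andP[g0s Us] c_hom; rewrite big_cons; set t' := \sum_(g <- s) c g.
move=> Jt t0; rewrite ltnS => sn.
have [c0|c0] := eqVneq (c g0) 0.
  by apply: IHn sn; rewrite // c0 add0r in Jt t0.
pose comm y := (c g0 + t') * y * c g0 - c g0 * y * (c g0 + t').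
have Jcomm y : J (comm y).
  apply: (idealB JI); first by do 2!apply: (Defs.idealMr JI).
  exact: (idealMl JI).
have commE y : comm y = \sum_(g <- s) (c g * y * c g0 - c g0 * y * c g).
  rewrite /comm mulrDr !mulrDl opprD addrACA subrr add0r sumrB.
  by rewrite -!mulr_suml -mulr_sumr.
pose c' p y h := let g := (h * (p * g0)^-1)%g in c g * y * c g0 - c g0 * y * c g.
have c'_hom p y : env_grade p y -> forall h, env_grade h (c' p y h).
  move=> py h; rewrite /c' /=; set g := (h * _)%g.
  have def_h : h = (g * p * g0)%g by rewrite -mulgA /g mulgVK.
  rewrite addrC -scaleN1r; apply: env_gradeP.
    have -> : h = (g0 * p * g)%g.
      by rewrite def_h G_abelian (G_abelian g) mulgA.
    by do ?apply: grade_mul.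
  by rewrite def_h; do ?apply: grade_mul.
have c'E p y : \sum_(h <- [seq (g * (p * g0))%g | g <- s]) c' p y h = comm y.
  by rewrite commE big_map; apply: eq_bigr => g _; rewrite /c' mulgK.
have Us' p : uniq [seq (g * (p * g0))%g | g <- s].
  by rewrite map_inj_uniq //; apply: mulIg.
have [[p [y [py y0]]]|ncomm] :=
  pselect (exists p y, env_grade p y /\ comm y <> 0).
  apply: (IHn _ (c' p y) (Us' p) (c'_hom p y py)); rewrite ?c'E ?size_map //.
  exact/eqP.
have comm0 p y g : env_grade p y -> g \in s -> c g * y * c g0 = c g0 * y * c g.
  move=> py gs; have := grade_indep (Us' p) (c'_hom p y py).
  rewrite c'E; have [->|cy0] := pselect (comm y = 0); last by case: ncomm; exists p, y.
  move=> /(_ (erefl _) _ (map_f (fun g => (g * (p * g0))%g) gs)) /=.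
  by rewrite /c' mulgK => /eqP; rewrite subr_eq0 => /eqP.
have [[g [gs /eqP cg0]]|cs0] := pselect (exists g, g \in s /\ c g <> 0).
  case/negP: g0s; suff <- : g = g0 by [].
  apply: (commuting_homogeneous (c_hom g) (c_hom g0) cg0 c0).
    by have := comm0 _ _ _ (env_grade1 _ _) gs; rewrite !mulr1.
  move=> i; apply: (comm0 (d i)) => //; rewrite -[y_ i]mulr1 -[d i]mulg1.
  by apply: env_gradeM (env_grade1 _ _); apply: (cb_hom L_basis).
have t'0 : t' = 0.
  rewrite /t' big_seq big1 // => g gs; apply: contrapT => cg.
  by apply: cs0; exists g.
by exists (c g0), g0; rewrite t'0 addr0 in Jt.
Qed.

End Grading.

(** * Automorphisms of U that are induced by fractions *)

Section Intertwiner.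
Variables (K : fieldType) (G : groupType).
Variables (eps : G -> G -> K) (eps_bichar : alternating_bicharacter eps).
Variables (L : lmodType K) (L_ : G -> L -> Prop) (br : L -> L -> L).
Hypothesis L_color : lie_color_algebra eps L_ br.
Hypothesis L_proper : proper_grading eps L_.
Variables (I : choiceType) (le : rel I) (e : I -> L) (d : I -> G).
Variable cd : L -> {malg K[I]}.
Hypothesis L_basis : color_basis eps L_ br le e d cd.
Variables (U : algType K) (iota : {linear L -> U}).
Hypothesis U_env : is_enveloping eps L_ br iota.

Local Notation W := (monomial le).
Local Notation P := {malg K[W]}.
Local Notation sort_word := (sort_word L_basis).
Local Notation y_ i := (iota (e i)).
Local Notation mon w := (\prod_(i <- w) y_ i).
Local Notation coef := (coef eps_bichar L_color L_basis U_env).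
Local Notation degU := (degU eps_bichar L_color L_basis U_env).
Local Notation phi := (phi eps_bichar L_color L_basis U_env).
Local Notation env_grade := (env_grade L_ iota).
Local Notation wdeg := (wdeg d).

Variables (tau : {lrmorphism U -> U}) (g : G) (a : U).
Hypotheses (tau_inj : injective tau) (a_hom : env_grade g a) (a_neq0 : a != 0).

(** If r w = w (tau r) for all r in U and a w lies in U, then b = a w satisfies
    a s a w = a w (tau (s a)), that is, a s b = b (tau s) (tau a): a trace in U
    of the normalizing element w of Q. *)
Definition intertwines (b : U) : Prop := forall s, a * s * b = b * tau s * tau a.

Lemma intertwines_lin (c : K) b b' :
  intertwines b -> intertwines b' -> intertwines (c *: b + b').
Proof.
by move=> ib ib' s; rewrite mulrDr -scalerAr ib ib' !mulrDl -!scalerAl.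
Qed.

Let domain u v : u * v = 0 -> u = 0 \/ v = 0 :=
  enveloping_domain eps_bichar L_color L_basis U_env (u := u) (v := v).

Lemma tau_neq0 u : u != 0 -> tau u != 0.
Proof. by move=> u0; rewrite -(inj_eq tau_inj) raddf0 in u0. Qed.

(** Degrees in a b = b (tau a). *)
Lemma degU_tau_a b : b != 0 -> intertwines b -> degU (tau a) = degU a.
Proof.
move=> b0 ib; have := congr1 degU (ib 1).
rewrite rmorph1 !mulr1 !degU_mul ?tau_neq0 // addnC.
by move/addnI.
Qed.

(** b tau(x) and a scalar multiple of x b have the same leading term. *)
Lemma degU_twisted_comm i b : b != 0 -> intertwines b ->
  (degU (eps g (d i) *: (y_ i * b) - b * tau (y_ i)) <= degU b)%N.
Proof.
move=> b0 ib; set D := _ - _; have [->|D0] := eqVneq D 0; first by rewrite degU0.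
have DE : D * tau a = eps g (d i) *: ((y_ i * a - eps (d i) g *: (a * y_ i)) * b).
  rewrite /D mulrBl -ib -scalerAl mulrBl scalerBr -scalerAl scalerA.
  rewrite (bicharC eps_bichar) scale1r; congr (_ *: _ - _).
  by have := ib 1; rewrite rmorph1 !mulr1 -!mulrA => ->.
rewrite -(leq_add2r (degU (tau a))) -degU_mul ?tau_neq0 // DE (degU_tau_a b0 ib).
apply: degUZ; apply: leq_trans (degUM _ _ _ _ _ _) _.
rewrite addnC leq_add2l.
by have := degU_comm eps_bichar L_color L_basis U_env i a;
   rewrite (phi_grade eps_bichar L_color L_basis U_env _ a_hom) -scalerAl.
Qed.

(** The words i M and M N are both leading for b tau(y_i), where M and N are
    leading for b and for tau(y_i); so N is the letter i. *)
Lemma lead_tau (r : rel I) i b :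
  total r -> transitive r -> antisymmetric r -> b != 0 -> intertwines b ->
  lead eps_bichar L_color L_basis U_env r (tau (y_ i)) [:: i].
Proof.
move=> r_total r_trans r_anti b0 ib.
have [M lb] := lead_exists eps_bichar L_color L_basis U_env r_total r_trans r_anti b0.
have y0 : y_ i != 0 := lead_neq0 (lead_gen eps_bichar L_color L_basis U_env r i).
have [N lN] := lead_exists eps_bichar L_color L_basis U_env r_total r_trans r_anti (tau_neq0 y0).
have lbN := leadM r_total r_trans r_anti lb lN.
have lib := leadM r_total r_trans r_anti (lead_gen eps_bichar L_color L_basis U_env r i) lb.
have : lead eps_bichar L_color L_basis U_env r (b * tau (y_ i)) ([:: i] ++ M).
  have -> : b * tau (y_ i) =
    eps g (d i) *: (y_ i * b) + (- 1) *: (eps g (d i) *: (y_ i * b) - b * tau (y_ i)).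
    by rewrite scaleN1r opprB addrC subrK.
  apply: lead_lower; first by apply: leadZ => //; apply: (bichar_neq0 eps_bichar).
  rewrite size_cat add1n ltnS -(lead_deg lb).
  by apply: degUZ; apply: degU_twisted_comm.
move/(lead_uniq r_total r_trans r_anti lbN); rewrite perm_sym.
rewrite (perm_catC [:: i] M) perm_cat2l perm_sym => pN.
by rewrite -(@perm_small_eq _ N [:: i] isT pN).
Qed.

Lemma ltc_single (r : rel I) i j : ltc r [:: j] [:: i] -> ~~ r i j.
Proof.
move=> [k [/=]]; rewrite !addn0; have [<-|//] := eqVneq j k.
have [//|neq_ij] := eqVneq i j; move=> _ eq_below; apply/negP => ij.
have := eq_below i ij neq_ij; rewrite /= eqxx !addn0.
by rewrite eq_sym (negPf neq_ij).
Qed.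

Lemma mon1 i : mon [:: i] = y_ i. Proof. exact: big_seq1. Qed.

Lemma coef_gen i : coef (y_ i) = << sort_word [:: i] >>.
Proof.
rewrite -mon1 -[in RHS](coef_mon_sorted eps_bichar L_color L_basis U_env).
by congr coef; apply: perm_small_eq.
Qed.

Lemma coef_atZ (c : K) u w : (coef (c *: u))@_w = c * (coef u)@_w.
Proof. by rewrite linearZ /= mcoeffZ. Qed.

Lemma coef_scalar (c : K) i : (coef (c *: 1))@_(sort_word [:: i]) = 0.
Proof.
rewrite linearZ /= coef1 mcoeffZ mcoeff_basis; case: eqP => [|_]; last by rewrite mulr0.
by move/(congr1 (fun w : W => size (val w))).
Qed.

(** The image of a generator x has x as leading monomial for the given order
    on the basis and for the opposite one, so no other generator occurs. *)
Lemma tau_gen i b : b != 0 -> intertwines b ->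
  exists c c' : K, tau (y_ i) = c *: y_ i + c' *: 1.
Proof.
move=> b0 ib; have le_total := cb_total L_basis.
have le_trans := cb_trans L_basis; have le_anti := cb_anti L_basis.
pose ge : rel I := fun i j => le j i.
have ge_total : total ge by move=> j k; apply: le_total.
have ge_trans : transitive ge by move=> j k l kj jl; apply: le_trans jl kj.
have ge_anti : antisymmetric ge by move=> j k /andP[? ?]; apply/le_anti/andP.
have l_le := lead_tau i le_total le_trans le_anti b0 ib.
have l_ge := lead_tau i ge_total ge_trans ge_anti b0 ib.
apply: (mon_ind (eps_bichar := eps_bichar) (L_color := L_color)
  (L_basis := L_basis) (U_env := U_env) (u := tau (y_ i))
  (S := fun u => exists c c' : K, u = c *: y_ i + c' *: 1)).
- by exists 0, 0; rewrite !scale0r addr0.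
- move=> c u v [c1 [c1' ->]] [c2 [c2' ->]]; exists (c * c1 + c2), (c * c1' + c2').
  by rewrite scalerDr !scalerA addrACA -!scalerDl.
move=> w wu; have := lead_upto l_le wu; have := lead_upto l_ge wu.
have small v : perm_eq v [:: i] -> exists c c' : K, mon v = c *: y_ i + c' *: 1.
  by move=> pv; exists 1, 0; rewrite (@perm_small_eq _ v [:: i]) // mon1 scale1r scale0r addr0.
have nil v : (size v < 1)%N -> exists c c' : K, mon v = c *: y_ i + c' *: 1.
  by case: v => // _; exists 0, 1; rewrite big_nil scale1r scale0r add0r.
case=> [/small //|[/nil //|[]]]; case: (val w) => [|j []] //= _ /ltc_single nji.
case=> [/small //|[/nil //|[_ /ltc_single nij]]].
by have := le_total i j; rewrite (negPf nij) (negPf (nji : ~~ le j i)).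
Qed.

(** In top degree, c b x = b tau(x) agrees with eps x b, and x b agrees with
    phi(b) x; so phi multiplies the top part of b by a scalar, and the degree of
    any top monomial of b tells which one. *)
Lemma tau_gen_scalar b : b != 0 -> intertwines b -> exists w,
  (coef b)@_w != 0 /\ forall i, exists c : K,
  tau (y_ i) = eps (d i) (g^-1 * wdeg (val w))%g *: y_ i + c *: 1.
Proof.
move=> b0 ib.
have [M lb] := lead_exists eps_bichar L_color L_basis U_env (cb_total L_basis)
  (cb_trans L_basis) (cb_anti L_basis) b0.
exists (sort_word M); have bM := lead_coef lb; split=> // i.
have [c [c' def_tau]] := tau_gen i b0 ib; exists c'; rewrite def_tau.
congr (_ *: _ + _); set k := wdeg _.
pose z := eps g (d i) *: phi (d i) b - c *: b.
have zM : (coef z)@_(sort_word M) = 0.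
  have zy : (degU (z * y_ i) <= degU b)%N.
    have -> : z * y_ i = (eps g (d i) *: (y_ i * b) - b * tau (y_ i)) +
        (c' *: b + - eps g (d i) *: (y_ i * b - phi (d i) b * y_ i)).
      rewrite /z def_tau mulrBl mulrDr -!scalerAl -!scalerAr mulr1 scaleNr scalerBr.
      by rewrite opprB opprD !addrA subrK [RHS](ACl (3*2*(1*4)))%AC /= subrr addr0.
    apply: degUD; first exact: degU_twisted_comm.
    apply: degU_lin => //; exact/degUZ/degU_comm.
  have [-> | z0] := eqVneq z 0; first by rewrite linear0 mcoeff0.
  have y1 : degU (y_ i) = 1%N := lead_deg (lead_gen eps_bichar L_color L_basis U_env le i).
  have y0 : y_ i != 0 := lead_neq0 (lead_gen eps_bichar L_color L_basis U_env le i).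
  move: zy; rewrite degU_mul // y1 addn1 (lead_deg lb) => zM.
  apply/eqP; rewrite mcoeff_eq0; apply/negP.
  move/((degU_le eps_bichar L_color L_basis U_env _ _).1 (leqnn _)).
  by rewrite size_sort_word leqNgt zM.
move: zM; rewrite /z addrC -scaleNr coef_at_lin coef_atZ coef_phi mulrA -mulrDl.
rewrite addrC.
move/eqP; rewrite mulf_eq0 (negPf bM) orbF subr_eq0 => /eqP <-.
by rewrite (bicharM eps_bichar) (bicharVr eps_bichar) (bicharV eps_bichar g).
Qed.

Lemma gen_scalar_uniq i (c1 c1' c2 c2' : K) :
  c1 *: y_ i + c1' *: 1 = c2 *: y_ i + c2' *: 1 -> c1 = c2.
Proof.
move/(congr1 (fun u => (coef u)@_(sort_word [:: i]))).
rewrite !coef_at_lin coef_gen mcoeff_basis eqxx !mulr1 !coef_scalar !addr0.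
by [].
Qed.

(** Modulo constants, tau acts on the generators as the grading automorphism
    phi of m^-1. *)
Definition translates (m : G) : Prop :=
  forall i, exists c : K, tau (y_ i) = eps (d i) m *: y_ i + c *: 1.

Lemma translates_uniq m m' : translates m -> translates m' -> m = m'.
Proof.
move=> tm tm'; apply: (degree_separated eps_bichar L_proper L_basis) => i.
have [c E] := tm i; have [c' E'] := tm' i.
by apply: (@gen_scalar_uniq i _ c _ c'); rewrite -E.
Qed.

Section Translates.
Variable m : G.
Hypothesis tau_m : translates m.

Lemma tau_iota h z : L_ h z -> exists c : K, tau (iota z) = eps h m *: iota z + c *: 1.
Proof.
move=> hz; rewrite (cb_span L_basis z) (lin_ext_comp _ _ (linearP iota)).
have tauP : linear tau by move=> x u v; rewrite linearP.
rewrite (lin_ext_comp _ _ tauP) lin_ext.unlock.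
have : forall i, i \in (msupp (cd z) : seq I) -> d i = h.
  by move=> i; apply: (cb_coord_deg L_basis hz).
elim: (msupp (cd z) : seq _) => [|i s IHs] s_deg.
  by exists 0; rewrite !big_nil scaler0 scale0r addr0.
have [|c Ec] := IHs _; first by move=> k ks; apply: s_deg; rewrite inE ks orbT.
have [c' Ec'] := tau_m i; exists ((cd z)@_i * c' + c).
rewrite !big_cons Ec /= Ec' s_deg ?mem_head // !scalerDr !scalerA addrACA -scalerDl.
by rewrite (mulrC (cd z)@_i).
Qed.

(** Applied to x y - eps y x = [x, y], where tau multiplies the quadratic and
    the linear terms by the same factor, tau leaves (1 - eps) (c_y x + c_x y) to
    be a constant, up to nonzero factors on x and y. *)
Lemma tau_constant i (c : K) :
  tau (y_ i) = eps (d i) m *: y_ i + c *: 1 -> c != 0 -> d i = 1%g.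
Proof.
move=> Ei c0; apply: (degree_separated eps_bichar L_proper L_basis) => j.
rewrite (bichar1r eps_bichar) (bicharV eps_bichar); apply: contrapT => neq1.
have neq : 1 - eps (d i) (d j) != 0.
  by rewrite subr_eq0 eq_sym; apply/eqP => E; rewrite E invr1 in neq1.
have neq_ij : i != j.
  by apply: contraNneq neq => <-; rewrite (cb_eps1 L_basis) subrr.
have [c' Ej] := tau_m j.
have [c2 Eij] := tau_iota (color_degree L_color (cb_hom L_basis i) (cb_hom L_basis j)).
have := congr1 tau (env_rel U_env (cb_hom L_basis i) (cb_hom L_basis j)).
rewrite Eij linearB linearZ /= !rmorphM /= Ei Ej -(env_rel U_env (cb_hom L_basis i) (cb_hom L_basis j)).
rewrite (bicharMl eps_bichar); set p := eps (d i) m; set r := eps (d j) m; set q := eps _ _.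
have r0 : r != 0 by apply: (bichar_neq0 eps_bichar).
pose Z := (p * c') *: y_ i + ((r * c) *: y_ j + (c * c') *: 1).
have -> : (p *: y_ i + c *: 1) * (r *: y_ j + c' *: 1) = (p * r) *: (y_ i * y_ j) + Z.
  rewrite mulrDl !mulrDr -!scalerAl -!scalerAr !mul1r !mulr1 !scalerA.
  by rewrite -!addrA (mulrC c r).
have -> : (r *: y_ j + c' *: 1) * (p *: y_ i + c *: 1) = (p * r) *: (y_ j * y_ i) + Z.
  rewrite mulrDl !mulrDr -!scalerAl -!scalerAr !mul1r !mulr1 !scalerA.
  rewrite (mulrC r p) (mulrC c' p) (mulrC c' c) -!addrA; congr (_ + _).
  by rewrite addrCA.
rewrite scalerDr opprD addrACA scalerBr !scalerA (mulrC q (p * r)) => /addrI.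
rewrite -[X in X - _]scale1r -scalerBl => E.
have := congr1 (fun u => (coef u)@_(sort_word [:: j])) E; rewrite /= /Z coef_scalar coef_atZ.
rewrite !coef_at_lin coef_scalar addr0 !coef_gen !mcoeff_basis eqxx.
have -> : (sort_word [:: i] == sort_word [:: j]) = false.
  apply/negP => /eqP/(sort_word_eq (L_basis := L_basis)) /(@perm_small_eq _ [:: i] [:: j] isT) [].
  exact/eqP.
rewrite mulr0 add0r mulr1 => /eqP.
by rewrite !mulf_eq0 (negPf neq) (negPf r0) (negPf c0).
Qed.

(** The constants in tau do no harm, as they occur only in degree 1, where phi k
    is the identity. *)
Lemma tau_phi k u : tau (phi k u) = phi k (tau u).
Proof.
move: u; apply: (enveloping_ind L_basis U_env) => [|x u v IHu IHv|i u IH].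
- by rewrite !rmorph1.
- by rewrite !linearP /= IHu IHv.
rewrite !rmorphM /= IH phi_gen linearZ /=; congr (_ * _).
have [c E] := tau_m i; rewrite E.
have -> : phi k (eps (d i) m *: y_ i + c *: 1) = eps (d i) m *: phi k (y_ i) + c *: 1.
  by rewrite linearP /= linearZ /= rmorph1.
rewrite phi_gen.
rewrite scalerDr !scalerA mulrC; congr (_ + _ *: _).
have [->|c0] := eqVneq c 0; first by rewrite mulr0.
by rewrite (tau_constant E c0) (bichar1r eps_bichar) mul1r.
Qed.

(** As tau commutes with phi k and a is an eigenvector, phi k can be applied to
    the identity that defines intertwines. *)
Lemma intertwines_phi k b : intertwines b -> intertwines (phi k b).
Proof.
move=> ib s; have <- := phiVK eps_bichar L_color L_basis U_env k s.
set s' := phi _ s; apply: (scalerI (bichar_neq0 eps_bichar k g)).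
have a_phi := phi_grade eps_bichar L_color L_basis U_env k a_hom.
have -> : eps k g *: (a * phi k s' * phi k b) = phi k (a * s' * b).
  by rewrite !rmorphM /= a_phi -!scalerAl.
rewrite ib !rmorphM /= -!tau_phi a_phi linearZ /= -scalerAr.
by [].
Qed.

End Translates.

(** The translate of b by phi_k, minus its expected value, intertwines as well;
    were it nonzero, a leading monomial of it would have the degree at which
    the difference cancels. *)
Theorem intertwiner_homogeneous b : b != 0 -> intertwines b ->
  exists m, [/\ translates m,
    forall i (c : K), tau (y_ i) = eps (d i) m *: y_ i + c *: 1 -> c != 0 -> d i = 1%g
    & forall k, phi k b = eps k (g * m)%g *: b].
Proof.
move=> b0 ib; have [w [_ tm]] := tau_gen_scalar b0 ib; set m := (_ * _)%g in tm.
exists m; split=> //; first exact: tau_constant.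
move=> k; apply/eqP; rewrite -subr_eq0; set b' := _ - _; apply: contraT => b'0.
have ib' : intertwines b'.
  rewrite /b' addrC -scaleNr; apply: intertwines_lin => //.
  exact: intertwines_phi tm k b ib.
have [v [b'v tm']] := tau_gen_scalar b'0 ib'.
move: b'v; rewrite /b' addrC -scaleNr coef_at_lin coef_phi.
by rewrite (translates_uniq tm tm') mulVKg mulNr addNr eqxx.
Qed.

End Intertwiner.

(** * Symmetric Martindale quotients of domains *)

Section SymmetricMartindale.
Variables (R Q : nzRingType) (j : {rmorphism R -> Q}).
Hypothesis j_mart : is_symmetric_martindale j.
Hypothesis R_domain : forall u v : R, u * v = 0 -> u = 0 \/ v = 0.

Lemma mart_inj : injective j.
Proof.
have [Ql [jl [t [jl_mart t_inj tj _]]]] := j_mart.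
by move=> u v /(congr1 t); rewrite !tj => /(lmart_inj jl_mart).
Qed.

Lemma mart_eq0 q (J : R -> Prop) : nonzero_ideal J ->
  (forall a, J a -> j a * q = 0) -> q = 0.
Proof.
have [Ql [jl [t [jl_mart t_inj tj _]]]] := j_mart.
move=> JI Jq; apply: t_inj; rewrite rmorph0; apply: (lmart_eq0 jl_mart JI) => a /Jq.
by rewrite -tj -rmorphM => ->; rewrite rmorph0.
Qed.

Lemma mart_frac q : exists2 J, nonzero_ideal J &
  forall a, J a -> (exists r, j a * q = j r) /\ (exists r, q * j a = j r).
Proof.
have [Ql [jl [t [jl_mart t_inj tj tP]]]] := j_mart.
have [J JI JP] : symmetric_elt jl (t q) by apply/tP; exists q.
exists J => // a /JP[[r ar] [r' ra]]; split; [exists r | exists r']; apply: t_inj.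
  by rewrite rmorphM !tj.
by rewrite rmorphM !tj.
Qed.

(** The second condition on f says that the element of the left quotient ring
    that it defines can also be multiplied into R from the right. *)
Lemma mart_hom (J J' : R -> Prop) f : nonzero_ideal J -> left_hom_on J f ->
  nonzero_ideal J' -> (forall a, J' a -> exists r, forall b, J b -> f b * a = b * r) ->
  exists q, forall a, J a -> j a * q = j (f a).
Proof.
have [Ql [jl [t [jl_mart t_inj tj tP]]]] := j_mart.
move=> JI f_hom J'I J'f; have [p pf] := lmart_hom jl_mart JI f_hom.
have [q tq] : exists q, t q = p.
  apply/tP; exists (fun a => J a /\ J' a); last first.
    move=> a [Ja /J'f[r fr]]; split; first by exists (f a); apply: pf.
    exists r; apply/eqP; rewrite -subr_eq0; apply/eqP.
    apply: (lmart_eq0 jl_mart JI) => b Jb.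
    by rewrite mulrBr mulrA pf // -!rmorphM fr // subrr.
  split=> [a b [Ja J'a] [Jb J'b]|r a [Ja J'a]|r a [Ja J'a]|].
  - by split; apply: idealB.
  - by split; apply: idealMl.
  - by split; apply: Defs.idealMr.
  have [a Ja a0] := ideal_neq0 JI; have [b J'b b0] := ideal_neq0 J'I.
  exists (a * b); first by split; [apply: Defs.idealMr | apply: idealMl].
  by apply/eqP => /R_domain[/eqP|/eqP]; rewrite ?(negPf a0) ?(negPf b0).
by exists q => a Ja; apply: t_inj; rewrite rmorphM !tj tq pf.
Qed.

Lemma domain_neq0 (u v : R) : u != 0 -> v != 0 -> u * v != 0.
Proof.
by move=> u0 v0; apply/eqP => /R_domain[/eqP|/eqP]; rewrite ?(negPf u0) ?(negPf v0).
Qed.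

Lemma ideal_cap (J J' : R -> Prop) : nonzero_ideal J -> nonzero_ideal J' ->
  nonzero_ideal (fun a => J a /\ J' a).
Proof.
move=> JI J'I; split=> [a b [Ja J'a] [Jb J'b]|r a [Ja J'a]|r a [Ja J'a]|].
- by split; apply: idealB.
- by split; apply: idealMl.
- by split; apply: Defs.idealMr.
have [a Ja a0] := ideal_neq0 JI; have [b J'b b0] := ideal_neq0 J'I.
exists (a * b); last exact: domain_neq0.
by split; [apply: Defs.idealMr | apply: idealMl].
Qed.

(** ** Extension of automorphisms *)

Section Extension.
Variables (s s' : {rmorphism R -> R}).
Hypotheses (sK : cancel s s') (s'K : cancel s' s).

(** q' is the class of s(a) |-> s(a q) when q is the class of a |-> a q. *)
Definition corresponds (q q' : Q) : Prop := exists2 J, nonzero_ideal J &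
  forall a, J a -> exists2 r, j a * q = j r & j (s a) * q' = j (s r).

Lemma ideal_image (J : R -> Prop) :
  nonzero_ideal J -> nonzero_ideal (fun a => J (s' a)).
Proof.
move=> JI; split=> [a b Ja Jb|r a Ja|r a Ja|].
- by rewrite rmorphB; apply: idealB.
- by rewrite rmorphM; apply: idealMl.
- by rewrite rmorphM; apply: Defs.idealMr.
have [a Ja a0] := ideal_neq0 JI; exists (s a); first by rewrite sK.
by rewrite -(inj_eq (can_inj s'K)) sK rmorph0.
Qed.

Lemma corresponds_exists q : exists q', corresponds q q'.
Proof.
have [J JI JP] := mart_frac q.
have [f fP] : exists f : R -> R, forall a, J a -> j a * q = j (f a).
  suff : forall a, exists r, J a -> j a * q = j r by move=> /choice[h hP]; exists h.
  move=> a.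
  have [Ja|nJa] := pselect (J a); last by exists 0.
  by have [[r ar] _] := JP a Ja; exists r.
have f_hom : left_hom_on J f.
  split=> [a b Ja Jb|r a Ja]; apply: mart_inj; rewrite -fP.
  - by rewrite rmorphD mulrDl !fP // rmorphD.
  - have -> : a + b = a - (0 - b) by rewrite sub0r opprK.
    by do 2!apply: (idealB JI) => //; rewrite -(subrr a); apply: (idealB JI).
  - by rewrite rmorphM -mulrA fP // rmorphM.
  exact: (idealMl JI).
have g_hom : left_hom_on (fun a => J (s' a)) (fun a => s (f (s' a))).
  split=> [a b Ja Jb|r a Ja]; first by rewrite rmorphD f_hom.1 // rmorphD.
  by rewrite rmorphM f_hom.2 // rmorphM s'K.
have [|q' q'P] := mart_hom (ideal_image JI) g_hom (ideal_image JI).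
  move=> a /JP[_ [r qr]]; exists (s r) => b Jb /=.
  rewrite -[a]s'K -[b in RHS]s'K -!rmorphM; congr (s _); apply: mart_inj.
  by rewrite !rmorphM -fP // -mulrA qr.
exists q', J => // a Ja; exists (f a); first exact: fP.
by rewrite q'P sK.
Qed.

Lemma corresponds_uniq q q1 q2 : corresponds q q1 -> corresponds q q2 -> q1 = q2.
Proof.
move=> [J1 J1I J1P] [J2 J2I J2P]; apply/eqP; rewrite -subr_eq0; apply/eqP.
apply: (mart_eq0 (ideal_image (ideal_cap J1I J2I))) => a [/J1P[r1 E1 F1] /J2P[r2 E2 F2]].
rewrite s'K in F1 F2; rewrite mulrBr F1 F2.
have -> : r1 = r2 by apply: mart_inj; rewrite -E1 -E2.
exact: subrr.
Qed.

Lemma correspondsB q1 q1' q2 q2' : corresponds q1 q1' -> corresponds q2 q2' ->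
  corresponds (q1 - q2) (q1' - q2').
Proof.
move=> [J1 J1I J1P] [J2 J2I J2P]; exists (fun a => J1 a /\ J2 a).
  exact: ideal_cap.
move=> a [/J1P[r1 E1 F1] /J2P[r2 E2 F2]]; exists (r1 - r2).
  by rewrite mulrBr E1 E2 rmorphB.
by rewrite mulrBr F1 F2 !rmorphB.
Qed.

(** The denominators of q1 q2 are the a for which a q1 is a denominator of q2;
    asking it for all multiples a u makes them a two-sided ideal. *)
Lemma correspondsM q1 q1' q2 q2' : corresponds q1 q1' -> corresponds q2 q2' ->
  corresponds (q1 * q2) (q1' * q2').
Proof.
move=> [J1 J1I J1P] [J2 J2I J2P].
exists (fun a => forall u, J1 (a * u) /\ exists2 r, j (a * u) * q1 = j r & J2 r); last first.
  move=> a /(_ 1); rewrite mulr1 => -[/J1P[r E F] [r']].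
  rewrite E => /mart_inj <- /J2P[r2 E2 F2]; exists r2.
    by rewrite mulrA E E2.
  by rewrite mulrA F F2.
split=> [a b Ja Jb u|r a Ja u|r a Ja u|].
- have [J1a [ra Ea J2a]] := Ja u; have [J1b [rb Eb J2b]] := Jb u.
  rewrite mulrBl; split; first exact: (idealB J1I).
  by exists (ra - rb); [rewrite rmorphB mulrBl Ea Eb rmorphB | apply: (idealB J2I)].
- have [J1a [ra Ea J2a]] := Ja u; rewrite -mulrA; split; first exact: (idealMl J1I).
  by exists (r * ra); [rewrite rmorphM -mulrA Ea rmorphM | apply: (idealMl J2I)].
- by rewrite -mulrA; apply: Ja.
have [a J1a a0] := ideal_neq0 J1I; have [b J2b b0] := ideal_neq0 J2I.
exists (b * a); last exact: domain_neq0.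
move=> u; rewrite -mulrA; have J1au : J1 (a * u) by apply: (Defs.idealMr J1I).
split; first exact: (idealMl J1I).
have [r E _] := J1P _ J1au; exists (b * r); last exact: (Defs.idealMr J2I).
by rewrite rmorphM -mulrA E rmorphM.
Qed.

Lemma corresponds_j u : corresponds (j u) (j (s u)).
Proof.
exists (fun=> True); last by move=> a _; exists (a * u); rewrite !rmorphM.
by split=> //; exists 1 => //; apply: oner_neq0.
Qed.

End Extension.

Section ExtensionMorphism.
Variables (s s' : {rmorphism R -> R}).
Hypotheses (sK : cancel s s') (s'K : cancel s' s).

Lemma corresponds_inv q q' : corresponds s q q' -> corresponds s' q' q.
Proof.
move=> [J JI JP]; exists (fun a => J (s' a)); first exact: (ideal_image sK s'K).
by move=> a /JP[r E F]; exists (s r); rewrite ?sK // -F s'K.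
Qed.

(** Each q corresponds to exactly one q', which defines the extension; the one
    built from the inverse of s is its inverse. *)
Lemma extend_automorphism : exists2 Phi : {rmorphism Q -> Q},
  bijective Phi & forall u, Phi (j u) = j (s u).
Proof.
have [F FP] := choice (corresponds_exists sK s'K).
have [F' F'P] := choice (corresponds_exists s'K sK).
have F1 : F 1 = 1.
  apply: (corresponds_uniq sK s'K (FP 1)).
  by have := corresponds_j s 1; rewrite !rmorph1.
have FB : zmod_morphism F.
  by move=> q q'; apply: (corresponds_uniq sK s'K (FP _)); apply: correspondsB.
have FM : GRing.monoid_morphism F.
  split=> // q q'; apply: (corresponds_uniq sK s'K (FP _)); exact: correspondsM.
pose Phi : {rmorphism Q -> Q} := HB.pack F (GRing.isZmodMorphism.Build Q Q F FB)
  (GRing.isMonoidMorphism.Build Q Q F FM).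
exists Phi; last first.
  by move=> u; apply: (corresponds_uniq sK s'K (FP _)); apply: corresponds_j.
exists F' => q.
  by apply: (corresponds_uniq s'K sK (F'P _)); apply: corresponds_inv.
apply: (corresponds_uniq sK s'K (FP _)).
have [J JI JP] := F'P q; exists (fun a => J (s a)); first exact: (ideal_image s'K sK).
by move=> a /JP[r E F0]; exists (s' r); rewrite ?s'K // -F0 sK.
Qed.

End ExtensionMorphism.

(** ** Normalizing elements *)

Section Normalizing.
Variable w : Q.
Hypotheses (w0 : w != 0) (wN : in_N j w).

Lemma normalizing_frac : exists a b, b != 0 /\ j a * w = j b.
Proof.
have [J JI JP] := mart_frac w; apply: contrapT => nab; case/eqP: w0.
apply: (mart_eq0 JI) => a /JP[[b ab] _]; rewrite ab.
have [->|b0] := eqVneq b 0; first by rewrite rmorph0.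
by case: nab; exists a, b.
Qed.

Lemma normalizing_regl r : j r * w = 0 -> r = 0.
Proof.
have [a [b [b0 ab]]] := normalizing_frac; move=> rw0.
have [a' aw] := wN.2 a; have /R_domain[//|/eqP] : r * b = 0; last by rewrite (negPf b0).
by apply: mart_inj; rewrite rmorphM -ab aw mulrA rw0 mul0r rmorph0.
Qed.

Lemma normalizing_regr r : w * j r = 0 -> r = 0.
Proof.
have [a [b [b0 ab]]] := normalizing_frac; move=> wr0.
have br0 : b * r = 0.
  by apply: mart_inj; rewrite rmorphM -ab -mulrA wr0 mulr0 rmorph0.
by have [/eqP|//] := R_domain br0; rewrite (negPf b0).
Qed.

Lemma normalizing_cancelr r r' : j r * w = j r' * w -> r = r'.
Proof.
move/eqP; rewrite -subr_eq0 -mulrBl -rmorphB => /eqP/normalizing_regl/eqP.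
by rewrite subr_eq0 => /eqP.
Qed.
Lemma normalizing_cancell r r' : w * j r = w * j r' -> r = r'.
Proof.
move/eqP; rewrite -subr_eq0 -mulrBr -rmorphB => /eqP/normalizing_regr/eqP.
by rewrite subr_eq0 => /eqP.
Qed.

Lemma normalizing_induces : exists s, induces j w s.
Proof.
have [s sP] := choice wN.1; have [s' s'P] := choice wN.2.
exists s; split=> //; split.
- exists s' => r; first by apply: normalizing_cancell; rewrite -s'P sP.
  by apply: normalizing_cancelr; rewrite -sP s'P.
- by move=> a b; apply: normalizing_cancelr; rewrite -sP !rmorphD mulrDl mulrDr !sP.
- move=> a b; apply: normalizing_cancelr.
  by rewrite -sP !rmorphM mulrA sP -mulrA sP mulrA.
by apply: normalizing_cancelr; rewrite -sP !rmorph1 mulr1 mul1r.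
Qed.

(** The inverse of w is the class of a w |-> a on the ideal of those elements
    of R that are left multiples of w by elements of a denominator ideal. *)
Lemma normalizing_inverse : exists v, v * w = 1 /\ w * v = 1.
Proof.
have [J JI JP] := mart_frac w.
pose Jw b := exists2 a, J a & j a * w = j b.
pose wJ b := exists2 a, J a & w * j a = j b.
have [a0 Ja0 a0_neq0] := ideal_neq0 JI.
have JwI : nonzero_ideal Jw.
  split=> [b b' [a Ja ab] [a' Ja' ab']|r b [a Ja ab]|r b [a Ja ab]|].
  - by exists (a - a'); [apply: (idealB JI) | rewrite rmorphB mulrBl ab ab' rmorphB].
  - by exists (r * a); [apply: (idealMl JI) | rewrite rmorphM -mulrA ab rmorphM].
  - have [r' wr] := wN.1 r; exists (a * r'); first exact: (Defs.idealMr JI).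
    by rewrite !rmorphM -ab -!mulrA wr.
  have [[b ab] _] := JP a0 Ja0; exists b; first by exists a0.
  apply: contraNneq a0_neq0 => b0; rewrite b0 rmorph0 in ab.
  by rewrite (normalizing_regl ab).
have wJI : nonzero_ideal wJ.
  split=> [b b' [a Ja ab] [a' Ja' ab']|r b [a Ja ab]|r b [a Ja ab]|].
  - by exists (a - a'); [apply: (idealB JI) | rewrite rmorphB mulrBr ab ab' rmorphB].
  - have [r' rw] := wN.2 r; exists (r' * a); first exact: (idealMl JI).
    by rewrite !rmorphM -ab !mulrA rw.
  - by exists (a * r); [apply: (Defs.idealMr JI) | rewrite rmorphM mulrA ab rmorphM].
  have [_ [b ab]] := JP a0 Ja0; exists b; first by exists a0.
  apply: contraNneq a0_neq0 => b0; rewrite b0 rmorph0 in ab.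
  by rewrite (normalizing_regr ab).
have [f fP] : exists f : R -> R, forall b, Jw b -> J (f b) /\ j (f b) * w = j b.
  suff : forall b, exists a, Jw b -> J a /\ j a * w = j b by move=> /choice[h hP]; exists h.
  move=> b.
  have [[a Ja ab]|nJb] := pselect (Jw b); last by exists 0.
  by exists a.
have JwD b b' : Jw b -> Jw b' -> Jw (b + b').
  move=> Jb Jb'; have -> : b + b' = b - (0 - b') by rewrite sub0r opprK.
  by do 2!apply: (idealB JwI) => //; rewrite -(subrr b); apply: (idealB JwI).
have f_hom : left_hom_on Jw f.
  split=> [b b' Jb Jb'|r b Jb]; apply: normalizing_cancelr.
    rewrite (fP _ (JwD _ _ Jb Jb')).2 !rmorphD mulrDl.
    by rewrite (fP _ Jb).2 (fP _ Jb').2.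
  rewrite (fP _ (idealMl JwI r Jb)).2 !rmorphM -mulrA.
  by rewrite (fP _ Jb).2.
have [|v vP] := mart_hom JwI f_hom wJI.
  move=> c [a Ja wa]; exists a => b Jb; apply: mart_inj.
  by rewrite !rmorphM -wa mulrA (fP _ Jb).2.
exists v; split; apply/eqP; rewrite -subr_eq0; apply/eqP.
  apply: (mart_eq0 JwI) => b Jb.
  by rewrite mulrBr mulrA vP // (fP _ Jb).2 mulr1 subrr.
apply: (mart_eq0 JI) => a Ja; have [[b ab] _] := JP a Ja.
have Jb : Jw b by exists a.
rewrite mulrBr mulrA ab vP // mulr1 -rmorphB.
have -> : f b = a by apply: normalizing_cancelr; rewrite (fP _ Jb).2.
by rewrite subrr rmorph0.
Qed.

End Normalizing.

Lemma normalizing1 : in_N j 1.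
Proof. by split=> r; exists r; rewrite mulr1 mul1r. Qed.

Lemma normalizingM w w' : in_N j w -> in_N j w' -> in_N j (w * w').
Proof.
move=> wN w'N; split=> r.
  have [r1 E1] := w'N.1 r; have [r2 E2] := wN.1 r1; exists r2.
  by rewrite -mulrA E1 mulrA E2 mulrA.
have [r1 E1] := wN.2 r; have [r2 E2] := w'N.2 r1; exists r2.
by rewrite mulrA E1 -mulrA E2 mulrA.
Qed.

Lemma normalizingV w v : in_N j w -> v * w = 1 -> w * v = 1 -> in_N j v.
Proof.
move=> wN vw wv; split=> r.
  have [r' E] := wN.2 r; exists r'.
  by rewrite -[j r]mulr1 -wv [j r * _]mulrA E !mulrA vw mul1r.
have [r' E] := wN.1 r; exists r'.
by rewrite -[j r]mul1r -vw -[v * w * _]mulrA E -!mulrA wv mulr1.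
Qed.

Lemma inverse_neq0 (v w : Q) : v * w = 1 -> v != 0 /\ w != 0.
Proof.
move=> vw; split; apply/eqP => E; move: vw; rewrite E ?mul0r ?mulr0 => /esym/eqP;
by rewrite oner_eq0.
Qed.

Lemma normalizingM_neq0 w w' : w != 0 -> in_N j w -> w' != 0 -> w * w' != 0.
Proof.
move=> w0 wN w'0; have [v [vw _]] := normalizing_inverse w0 wN.
by apply: contraNneq w'0 => ww'; rewrite -[w']mul1r -vw -mulrA ww' mulr0.
Qed.

(** An element that commutes with R commutes with Q, where every element is a
    fraction with denominators in R. *)
Lemma commutes_with_Q z q : (forall r, z * j r = j r * z) -> z * q = q * z.
Proof.
move=> zC; have [J JI JP] := mart_frac q; apply/eqP; rewrite -subr_eq0; apply/eqP.
apply: (mart_eq0 JI) => a /JP[[r aq] _].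
by rewrite mulrBr mulrA -zC -mulrA aq mulrA aq zC subrr.
Qed.

End SymmetricMartindale.

(** * X-inner automorphisms *)

Section XInner.
Variables (K : fieldType) (G : groupType) (G_abelian : abelian_group G).
Variables (eps : G -> G -> K) (eps_bichar : alternating_bicharacter eps).
Variables (L : lmodType K) (L_ : G -> L -> Prop) (br : L -> L -> L).
Hypothesis L_color : lie_color_algebra eps L_ br.
Hypothesis L_proper : proper_grading eps L_.
Variables (I : choiceType) (le : rel I) (e : I -> L) (d : I -> G).
Variable cd : L -> {malg K[I]}.
Hypothesis L_basis : color_basis eps L_ br le e d cd.
Variables (U : algType K) (iota : {linear L -> U}).
Hypothesis U_env : is_enveloping eps L_ br iota.
Variables (Q : algType K) (j : {lrmorphism U -> Q}).
Hypothesis Q_mart : is_symmetric_martindale j.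

Local Notation y_ i := (iota (e i)).
Local Notation phi := (phi eps_bichar L_color L_basis U_env).
Local Notation env_grade := (env_grade L_ iota).
Local Notation semi_invariant := (homogeneous_semi_invariant eps L_ iota j).

Let domain (u v : U) : u * v = 0 -> u = 0 \/ v = 0 :=
  enveloping_domain eps_bichar L_color L_basis U_env (u := u) (v := v).
Let j_inj : injective j := mart_inj Q_mart.

(** The relation x q - eps q x = c q moves q past the generators, hence past
    U. *)
Lemma semi_invariant_normalizing q : semi_invariant q -> in_N j q.
Proof.
move=> [g _ q_inv].
have q_gen i : exists c : K, j (y_ i) * q = eps (d i) g *: (q * j (y_ i)) + c *: q.
  have [c] := q_inv (d i) (e i) (cb_hom L_basis i); rewrite /delta => E.
  by exists c; rewrite -E addrC subrK.
split; apply: (enveloping_ind L_basis U_env).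
- by exists 1; rewrite !rmorph1 mulr1 mul1r.
- move=> c u v [u' Eu] [v' Ev]; exists (c *: u' + v').
  by rewrite /= !linearP /= mulrDr mulrDl -scalerAr -scalerAl Eu Ev.
- move=> i u [u' Eu]; have [c E] := q_gen i.
  exists ((eps (d i) g)^-1 *: (y_ i - c *: 1) * u').
  move: Eu => /= Eu; rewrite !rmorphM /= mulrA -[in RHS]mulrA -Eu mulrA; congr (_ * _).
  rewrite linearZ /= linearB /= linearZ /= rmorph1 -scalerAl mulrBl E -scalerAl mul1r.
  by rewrite addrK scalerA mulVf ?scale1r // (bichar_neq0 eps_bichar).
- by exists 1; rewrite !rmorph1 mulr1 mul1r.
- move=> c u v [u' Eu] [v' Ev]; exists (c *: u' + v').
  by rewrite /= !linearP /= mulrDr mulrDl -scalerAr -scalerAl Eu Ev.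
move=> i u [u' Eu]; have [c E] := q_gen i.
exists ((eps (d i) g *: y_ i + c *: 1) * u').
move: Eu => /= Eu; rewrite !rmorphM /= -mulrA Eu !mulrA; congr (_ * _).
by rewrite E linearP /= linearZ /= rmorph1 mulrDr -!scalerAr mulr1.
Qed.

(** The scalars are central in Q, so that induced automorphisms are linear. *)
Lemma induced_inverse q s : induces j q s -> exists tau : {lrmorphism U -> U},
  [/\ cancel s tau, cancel tau s & forall r, j r * q = q * j (tau r)].
Proof.
move=> [q0 qN [[t sK tK] sD sM s1] sq].
have tq r : j r * q = q * j (t r) by rewrite -sq tK.
have can := normalizing_cancell Q_mart domain q0.
have t_lin : linear t.
  move=> c u v; apply: can; rewrite -tq /= !linearP /= mulrDl mulrDr.
  by rewrite -scalerAl -scalerAr !tq.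
have t_mul : GRing.monoid_morphism t.
  split=> [|u v]; apply: can; first by rewrite -tq /= !rmorph1 mul1r mulr1.
  by rewrite -tq /= !rmorphM /= -mulrA tq mulrA tq mulrA.
pose tau : {lrmorphism U -> U} := HB.pack t (GRing.isLinear.Build K U U *:%R t t_lin)
  (GRing.isMonoidMorphism.Build U U t t_mul).
by exists tau.
Qed.

Section Induced.
Variables (q : Q) (s : U -> U) (tau : {lrmorphism U -> U}).
Hypotheses (q_s : induces j q s) (sK : cancel s tau) (tauK : cancel tau s).
Hypothesis q_tau : forall r, j r * q = q * j (tau r).

(** The ideal of denominators of q contains a homogeneous a, and then a q is the
    element b of U to which the results on intertwiners apply. *)
Lemma induced_translates : exists m, [/\ translates eps e d iota tau m,
    forall i (c : K), tau (y_ i) = eps (d i) m *: y_ i + c *: 1 -> c != 0 -> d i = 1%g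
    & exists a g b, [/\ env_grade g a, a != 0, j a * q = j b
    & forall k, phi k b = eps k (g * m)%g *: b]].
Proof.
have [q0 qN _ _] := q_s; have [J JI JP] := mart_frac Q_mart q.
have [a [g [Ja a0 ga]]] :=
  ideal_homogeneous G_abelian eps_bichar L_color L_proper L_basis U_env JI.
have [[b ab] _] := JP a Ja.
have b0 : b != 0.
  apply: contraNneq a0 => b0; move: ab; rewrite b0 rmorph0.
  by move/(normalizing_regl Q_mart domain q0 qN)->.
have ib : intertwines tau a b.
  move=> r; apply: j_inj; move: ab q_tau => /= ab tq; rewrite !rmorphM /= -ab.
  by rewrite -[RHS]mulrA -(mulrA _ q) (mulrA q) -tq -(mulrA _ q) -tq !mulrA.
have [m [tm tc bm]] := intertwiner_homogeneous eps_bichar L_color L_proper L_basis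
  U_env (can_inj tauK) ga a0 b0 ib.
by exists m; split=> //; exists a, g, b.
Qed.

End Induced.

(** On generators, r q = q (tau r) is the semi-invariance of q. As for its
    degree, phi k extends to Phi on Q; since a and b = a q are homogeneous, Phi q
    and the expected multiple of q have the same products with a r for all r,
    which determines them. *)
Lemma induces_semi_invariant q s : induces j q s -> semi_invariant q.
Proof.
move=> q_s; have [tau [sK tauK q_tau]] := induced_inverse q_s.
have [m [tm tc [a [g [b [ga a0 ab b_phi]]]]]] := induced_translates q_s tauK q_tau.
have [q0 qN _ _] := q_s.
have phiK k : cancel (phi k) (phi k^-1%g).
  by move=> u; rewrite -{2}[k]invgK phiVK.
exists m => [k|h x hx]; last first.
  have [c E] := tau_iota L_basis tm hx; exists c.
  rewrite /delta q_tau E linearP /= linearZ /= rmorph1 mulrDr -!scalerAr mulr1.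
  by rewrite addrAC subrr add0r.
have [Phi Phi_bij PhiE] := extend_automorphism Q_mart domain (phiK k)
  (phiVK eps_bichar L_color L_basis U_env k).
exists Phi; first by split=> // h u hu; rewrite PhiE /= (phi_grade eps_bichar L_color L_basis U_env k hu).
apply/eqP; rewrite -subr_eq0; set z := _ - _; apply/eqP.
have az r : j (a * r) * z = 0.
  have [r' ->] : exists r', r = phi k r' by exists (phi k^-1%g r); rewrite phiVK.
  have art u : j (a * u) * q = j (b * tau u) by rewrite !rmorphM /= -mulrA q_tau mulrA ab.
  have E : eps k g *: (j (a * phi k r') * Phi q) = eps k (g * m)%g *: (j (a * phi k r') * q).
    transitivity (Phi (j (a * r') * q)).
      have -> : Phi (j (a * r') * q) = Phi (j (a * r')) * Phi q by rewrite rmorphM.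
      rewrite PhiE /= [phi k (a * r')]rmorphM /= (phi_grade eps_bichar L_color L_basis U_env k ga).
      by rewrite -scalerAl linearZ /= -scalerAl.
    rewrite !art PhiE /= [phi k (b * _)]rmorphM /= b_phi -scalerAl linearZ.
    by rewrite (tau_phi _ L_color L_proper L_basis U_env tm).
  apply: (scalerI (bichar_neq0 eps_bichar k g)); rewrite scaler0 mulrBr scalerBr E.
  by rewrite -scalerAr scalerA -(bicharM eps_bichar) subrr.
apply: (mart_eq0 Q_mart (J := fun c => forall r, j (c * r) * z = 0)); last first.
  by move=> c /(_ 1); rewrite mulr1.
split=> [c c' cz c'z r|r c cz r'|r c cz r'|].
- by rewrite mulrBl rmorphB mulrBl cz c'z subrr.
- by rewrite -mulrA rmorphM -mulrA cz mulr0.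
- by rewrite -mulrA.
by exists a.
Qed.

Lemma semi_invariantP q : q != 0 ->
  ((exists s, induces j q s) <-> semi_invariant q).
Proof.
move=> q0; split=> [[s]|/semi_invariant_normalizing qN].
  exact: induces_semi_invariant.
exact: normalizing_induces.
Qed.

(** On a generator, two induced automorphisms are both the same scaling up to
    constants, and the constants occur only where the scalings are trivial. *)
Lemma induced_commute s s' u : X_inner j s -> X_inner j s' -> s (s' u) = s' (s u).
Proof.
move=> [q q_s] [q' q_s'].
have [tau [sK tauK q_tau]] := induced_inverse q_s.
have [tau' [s'K tau'K q'_tau]] := induced_inverse q_s'.
have [m [tm tc _]] := induced_translates q_s tauK q_tau.
have [m' [tm' tc' _]] := induced_translates q_s' tau'K q'_tau.
have tauC : forall v, tau (tau' v) = tau' (tau v).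
  apply: (enveloping_ind L_basis U_env) => [|c v v' IH IH'|i v IH].
  - by rewrite !rmorph1.
  - by rewrite !linearP /= IH IH'.
  rewrite !rmorphM /= IH; congr (_ * _).
  have [c E] := tm i; have [c' E'] := tm' i; rewrite E E' !linearP /= E E' !linearZ /= !rmorph1.
  rewrite !scalerDr !scalerA -!addrA (mulrC (eps (d i) m')).
  congr (_ + _); rewrite -!scalerDl; congr (_ *: _).
  have [c0|c0] := eqVneq c 0; have [c'0|c'0] := eqVneq c' 0.
  - by rewrite c0 c'0 !mulr0.
  - by rewrite (tc' i c' E' c'0) !(bichar1l eps_bichar) !mul1r addrC.
  - by rewrite (tc i c E c0) !(bichar1l eps_bichar) !mul1r addrC.
  by rewrite (tc i c E c0) !(bichar1l eps_bichar) !mul1r addrC.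
apply: (can_inj tauK); apply: (can_inj tau'K).
by rewrite sK s'K -tauC s'K sK.
Qed.

(** Normalizing elements are closed under products and inverses, and induced
    automorphisms commute. *)
Lemma X_inner_group : forms_group (fun s t : U -> U => s \o t) id (X_inner j) abelian_group.
Proof.
apply: forms_group_subset => //.
- exists 1; split; first exact: oner_neq0; first exact: normalizing1.
    by split=> //; exists id.
  by move=> r; rewrite mulr1 mul1r.
- move=> s t [q [q0 qN [s_bij sD sM s1] sq]] [q' [q'0 q'N [t_bij tD tM t1] tq']].
  exists (q * q'); split.
  + exact: (normalizingM_neq0 Q_mart domain q0 qN q'0).
  + exact: normalizingM.
  + split; first exact: bij_comp.
    * by move=> a b /=; rewrite tD sD.
    * by move=> a b /=; rewrite tM sM.
    * by rewrite /= t1 s1.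
  by move=> r; rewrite /= mulrA sq -mulrA tq' mulrA.
- move=> s [q q_s]; have [q0 qN [s_bij sD sM s1] sq] := q_s.
  have [tau [sK tauK q_tau]] := induced_inverse q_s.
  have [v [vq qv]] := normalizing_inverse Q_mart domain q0 qN.
  exists tau; last by apply/funext => u /=; rewrite sK.
  exists v; split; first exact: (inverse_neq0 vq).1; first exact: normalizingV qN vq qv.
    split=> [|a b|a b|]; [|exact: rmorphD|exact: rmorphM|exact: rmorph1].
    by exists s.
  move=> r; rewrite -[LHS]mul1r -vq -mulrA (mulrA q) -q_tau -mulrA.
  by rewrite qv mulr1.
move=> H f f_inj _ fM fS x y; apply: f_inj; rewrite !fM; apply/funext => u /=.
exact: (induced_commute u (fS x) (fS y)).
Qed.

(** The commutator of two normalizing elements induces a commutator of induced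
    automorphisms, the identity; so it commutes with U, hence with Q. *)
Lemma semi_invariant_group : forms_group (fun p q : Q => p * q) 1
  (fun q => q != 0 /\ semi_invariant q) (fun H => nilpotent_class_le H 2).
Proof.
pose N q := q != 0 /\ in_N j q.
have NS q : N q <-> q != 0 /\ semi_invariant q.
  split=> -[q0 qP]; split=> //; last exact: semi_invariant_normalizing.
  by apply/(semi_invariantP q0)/(normalizing_induces Q_mart domain).
have -> : (fun q => q != 0 /\ semi_invariant q) = N.
  by apply/funext => q; apply/propext; split=> /NS.
apply: forms_group_subset => //.
- exact: mulrA.
- by move=> q _; rewrite mul1r.
- by split; [apply: oner_neq0 | apply: normalizing1].
- move=> p q [p0 pN] [q0 qN]; split; last exact: normalizingM.
  exact: (normalizingM_neq0 Q_mart domain p0 pN q0).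
- move=> q [q0 qN]; have [v [vq qv]] := normalizing_inverse Q_mart domain q0 qN.
  exists v => //; split; first exact: (inverse_neq0 vq).1.
  exact: normalizingV qN vq qv.
move=> H f f_inj f1 fM fN.
have f_unit x : f (x^-1)%g * f x = 1 by rewrite -fM mulVg.
have f_cancel x p q : f x * p = f x * q -> p = q.
  by move=> E; rewrite -[p]mul1r -[q]mul1r -(f_unit x) -!mulrA E.
have ind x : exists2 s, X_inner j s & forall r, j (s r) * f x = f x * j r.
  have [fx0 fxN] := fN x.
  have [s [? ? ? sE]] := normalizing_induces Q_mart domain fx0 fxN.
  by exists s => //; exists (f x).
have f_act x y s s' r : (forall r, j (s r) * f x = f x * j r) ->
    (forall r, j (s' r) * f y = f y * j r) ->
    f (x * y)%g * j r = j (s (s' r)) * f (x * y)%g.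
  by move=> sE s'E; rewrite fM -mulrA -s'E mulrA -sE mulrA.
have commg_central x y r : f (commg x y) * j r = j r * f (commg x y).
  have [s sX sE] := ind x; have [s' s'X s'E] := ind y.
  have xy : f (y * x)%g * f (commg x y) = f (x * y)%g.
    by rewrite -fM commgEl conjgE; congr f; rewrite !mulgA mulgK mulgV mul1g.
  apply: (f_cancel (y * x)%g); rewrite !mulrA xy (f_act x y s s') //.
  by rewrite (f_act y x s' s) // -mulrA xy (induced_commute r sX s'X).
have derived_central z : lower_central 1 z -> forall r, f z * j r = j r * f z.
  elim=> [t [x [y [_ ->]]]||x y _ IHx _ IHy|x _ IH] r.
  - exact: commg_central.
  - by rewrite f1 mul1r mulr1.
  - by rewrite fM -mulrA IHy mulrA IHx mulrA.
  by apply: (f_cancel x); rewrite !mulrA IH -fM mulgV f1 mul1r -mulrA -fM mulgV f1 mulr1.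
move=> x; elim=> [t [z [y [/derived_central zC ->]]]|//|a b _ -> _ ->|a _ ->].
- have /f_inj zy : f (z * y)%g = f (y * z)%g.
    by rewrite !fM (commutes_with_Q Q_mart).
  by rewrite commgEl conjgE zy mulKg mulVg.
- by rewrite mulg1.
by rewrite invg1.
Qed.

End XInner.

Theorem theorem2p7 (K : fieldType) (G : groupType) (G_abelian : abelian_group G)
    (eps : G -> G -> K) (eps_bichar : alternating_bicharacter eps)
    (L : lmodType K) (L_ : G -> L -> Prop) (br : L -> L -> L)
    (L_color : lie_color_algebra eps L_ br)
    (L_even : even_color eps L_ br)
    (L_proper : proper_grading eps L_)
    (U : algType K) (iota : {linear L -> U})
    (U_env : is_enveloping eps L_ br iota)
    (Q : algType K) (j : {lrmorphism U -> Q})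
    (Q_mart : is_symmetric_martindale j) :
  [/\ forms_group (fun s t : U -> U => s \o t) id (X_inner j) abelian_group,
      forall q : Q, q != 0 ->
        ((exists s : U -> U, induces j q s) <->
         homogeneous_semi_invariant eps L_ iota j q)
    & forms_group (fun p q : Q => p * q) 1
        (fun q : Q => q != 0 /\ homogeneous_semi_invariant eps L_ iota j q)
        (fun H => nilpotent_class_le H 2)].
Proof.
have [I [le [e [d [cd L_basis]]]]] := color_basis_exists L_color L_even.
split.
- exact: (X_inner_group G_abelian eps_bichar L_color L_proper L_basis U_env Q_mart).
- exact: (semi_invariantP G_abelian eps_bichar L_color L_proper L_basis U_env Q_mart).
exact: (semi_invariant_group G_abelian eps_bichar L_color L_proper L_basis U_env Q_mart).
Qed.
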